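(* Consider the problem $(GP)$ with data $F,\phi,\omega,t_0,T,\lambda,\sigma,k_0$ as described in the context. Suppose that $\omega:\mathbb{R}_+\to\mathbb{R}$ and $\phi:\mathbb{R}_+\to\mathbb{R}_+$ are continuous on $\mathbb{R}_+$. If, in addition, $\omega$ is concave on $\mathbb{R}_+$ and there exists $c\ge 0$ such that $$\phi(k)\le (c-\sigma)k+c\quad\text{for all } k\in\mathbb{R}_+,$$ then $(GP)$ has a global solution.
   Context: $\mathbb{R}_+=[0,+\infty)$. Data: a production function $F:\mathbb{R}_+^2\to\mathbb{R}_+$ with $F(\alpha K,\alpha L)=\alpha F(K,L)$ for all $\alpha>0$ and $(K,L)\in\mathbb{R}_+^2$; the per capita production function $\phi:\mathbb{R}_+\to\mathbb{R}_+$, $\phi(k):=F(k,1)$; a utility function $\omega:\mathbb{R}_+\to\mathbb{R}$; real parameters $T>t_0\ge 0$ (finite), $\lambda\ge 0$, $\sigma>0$, $k_0>0$. Problem $(GP)$: maximize $$I(k,s):=\int_{t_0}^{T}\omega\big[(1-s(t))\phi(k(t))\big]e^{-\lambda t}\,dt$$ over pairs $(k,s)$ with $k\in W^{1,1}([t_0,T],\mathbb{R})$ (i.e. $k$ absolutely continuous on $[t_0,T]$) and $s:[t_0,T]\to\mathbb{R}$ Lebesgue measurable satisfying $\dot k(t)=s(t)\phi(k(t))-\sigma k(t)$ for a.e. $t\in[t_0,T]$; $k(t_0)=k_0$; $s(t)\in[0,1]$ for a.e. $t\in[t_0,T]$; $k(t)\ge 0$ for all $t\in[t_0,T]$. A pair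 $(k,s)$ satisfying these requirements for which the integrand of $I$ is Lebesgue integrable is called a feasible process. A global solution of $(GP)$ is a feasible process $(\bar k,\bar s)$ such that $I(k,s)\le I(\bar k,\bar s)$ for every feasible process $(k,s)$. *)

(* Defs.v *)
From mathcomp Require Import all_boot all_order all_algebra.
From mathcomp Require Import all_classical all_reals all_analysis.
Set Implicit Arguments.
Unset Strict Implicit.
Unset Printing Implicit Defensive.
Import Order.TTheory GRing.Theory Num.Theory.
Import numFieldNormedType.Exports.
Local Open Scope classical_set_scope.
Local Open Scope ring_scope.

(* Functions on R_+ or on [t0, T] are represented by total functions R -> R.
   Values off the domain do not matter: the only times at which they can be
   used are t0, T (two-sided derivative) and those where s t is not in [0, 1],
   and these form a Lebesgue-null set.
   Measurability, "almost everywhere" and integrals refer to the completed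
   Lebesgue measure, i.e. to the sigma-algebra of Lebesgue (not only Borel)
   measurable sets, so changing s on a null set changes nothing. *)

Notation lebesgueR R := (@completed_lebesgue_measure R) (only parsing).

(* the carrier R equipped with the sigma-algebra of Lebesgue measurable sets *)
Notation lebesgueTypeR R :=
  (caratheodory_type ((wlength (@idfun R))^*)%mu) (only parsing).

Definition absolutely_continuous (R : realType) (a b : R) (f : R -> R) : Prop :=
  forall e : R, 0 < e -> exists2 d : R, 0 < d &
    forall (n : nat) (x y : 'I_n -> R),
      (forall i, [/\ a <= x i, x i <= y i & y i <= b]) ->
      trivIset setT (fun i => `]x i, y i[%classic) ->
      \sum_(i < n) (y i - x i) < d ->
      \sum_(i < n) `|f (y i) - f (x i)| < e.

Definition concave_function (R : realType) (D : set R) (f : R -> R) : Prop :=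
  @convex_function R R^o D (fun x => - f x).

Definition production_function (R : realType) (F : R -> R -> R) : Prop :=
  (forall K L, 0 <= K -> 0 <= L -> 0 <= F K L) /\
  (forall alpha K L, 0 < alpha -> 0 <= K -> 0 <= L ->
    F (alpha * K) (alpha * L) = alpha * F K L).

Definition per_capita (R : realType) (F : R -> R -> R) : R -> R :=
  fun k => F k 1.

Section growth_problem.
Context {R : realType}.
Implicit Types (omega phi k s : R -> R) (t T lambda sigma : R).

Definition integrand omega phi lambda k s t : R :=
  omega ((1 - s t) * phi (k t)) * expR (- lambda * t).

Definition objective omega phi t0 T lambda k s : R :=
  (\int[lebesgueR R]_(t in `[t0, T]) integrand omega phi lambda k s t)%R.

Record feasible_process omega phi t0 T lambda sigma (k0 : R) k s : Prop := {
  state_ac : absolutely_continuous t0 T k;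
  control_measurable :
    measurable_fun (`[t0, T] : set (lebesgueTypeR R)) s;
  state_equation : {ae lebesgueR R, forall t : R, t \in `[t0, T] ->
    is_derive t 1 k (s t * phi (k t) - sigma * k t)};
  state_init : k t0 = k0;
  control_constraint : {ae lebesgueR R, forall t : R, t \in `[t0, T] ->
    s t \in `[0, 1]};
  state_constraint : forall t : R, t \in `[t0, T] -> 0 <= k t;
  integrand_integrable :
    (lebesgueR R).-integrable `[t0, T]
      (EFin \o integrand omega phi lambda k s)
}.

Definition global_solution omega phi t0 T lambda sigma (k0 : R) k s : Prop :=
  feasible_process omega phi t0 T lambda sigma k0 k s /\
  forall k' s', feasible_process omega phi t0 T lambda sigma k0 k' s' ->
    objective omega phi t0 T lambda k' s' <= objective omega phi t0 T lambda k s.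

End growth_problem.

(* Main.v *)
From HB Require Import structures.
Require Import Defs.
From mathcomp Require Import all_boot all_order all_algebra.
From mathcomp Require Import all_classical all_reals all_analysis.
From mathcomp Require Import measurable_realfun ring lra.
Set Implicit Arguments.
Unset Strict Implicit.
Unset Printing Implicit Defensive.
Import Order.TTheory GRing.Theory Num.Theory.
Import numFieldNormedType.Exports.
Local Open Scope classical_set_scope.
Local Open Scope ring_scope.

(** Existence of an optimal control by the direct method, in the form due to
    Filippov and Cesari.

    In terms of the investment rate [y = s * phi k], the consumption is
    [phi k - y] and the dynamics [k' = y - sigma * k] become affine in the pair
    [(k, y)], while the control constraint reads [0 <= y <= phi k]. The
    objective is the integral of [omega (phi k - y)], discounted, and is concave
    in [y]. A maximizing sequence [(k_n, y_n)] can therefore be passed to the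
    limit as soon as [k_n] converges uniformly and [y_n] weakly, and the control
    is recovered from the limit as [s = y / phi k].

    Reduction ([feasible_reduced], [reduced_feasible]). The growth condition
    gives [k' <= c * k + c] a.e., hence by a Gronwall argument ([gronwall_ae])
    one bound and one Lipschitz constant for all feasible states. The rate [y]
    is chosen Borel, through a limit superior of difference quotients of [k]
    ([measurable_derivative]), so that only the Borel-Lebesgue measure is used
    until the result is transferred back to the completed measure. The a.e.
    state equation is exploited through [absolutely_continuous_nonincreasing]:
    an absolutely continuous function with nonpositive derivative a.e. does not
    increase. This follows from real induction along the interval, the
    exceptional null set being covered by a small open set.

    Compactness. Limits are taken along an ultrafilter on the indices, which
    makes every bounded real sequence convergent and spares all extractions of
    subsequences. The states converge pointwise, and uniformly by the common
    Lipschitz constant ([lipschitz_cvg_uniform]). The set function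
    [A |-> lim \int_A y_n] is a finite measure dominated by Lebesgue measure, and
    its Radon-Nikodym density is the weak limit of the rates
    ([bounded_weak_limit], [weak_cvg_bounded_test]); the inequalities
    [0 <= y <= phi k] survive because they can be tested on measurable sets
    ([control_limit]).

    Upper semicontinuity ([reward_limsup]). By concavity, a secant of [omega] at
    scale [e] based at [x] bounds [omega] from above up to the oscillation of
    [omega] at scale [e] ([concave_le_secant]). Evaluated at the limit
    consumption this is affine in [y_n] with a bounded measurable slope, so weak
    convergence applies. *)

(** * Real induction and almost-everywhere statements *)

(** A property that holds at [a] and propagates across a neighbourhood of each
    point of [[a, b]] holds at [b]. *)
Lemma real_induction (R : realType) (a b : R) (P : R -> Prop) : a <= b -> P a ->
  (forall c, a <= c <= b -> exists2 r, 0 < r & forall u v, a <= u -> v <= b ->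
     c - r < u -> u <= c -> c <= v -> v < c + r -> P u -> P v) -> P b.
Proof.
move=> ab Pa step.
pose S := [set x | a <= x <= b /\ P x].
have Sa : S a by split; rewrite ?lexx.
have supS : has_sup S.
  by split; [exists a|exists b => x [/andP[_ ->]]].
have ac : a <= sup S by apply: (ub_le_sup supS.2).
have cb : sup S <= b.
  by apply: ge_sup => [|x [/andP[_ ->]//]]; exists a.
have [r r0 rP] := step (sup S) (introT andP (conj ac cb)).
have [u [/andP[au ub] Pu] ltu] := sup_adherent r0 supS.
have uS : u <= sup S by apply: (ub_le_sup supS.2); split => //; rewrite au.
pose v := Num.min (sup S + r / 2) b.
have vb : v <= b by rewrite /v ge_min lexx orbT.
have Sv : sup S <= v by rewrite /v le_min cb andbT; lra.
have vr : v < sup S + r by rewrite /v gt_min; apply/orP; left; lra.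
have Pv := rP u v au vb ltu uS Sv vr Pu.
have : v <= sup S.
  by apply: (ub_le_sup supS.2); split => //; rewrite (le_trans ac Sv).
rewrite /v; case: (leP (sup S + r / 2) b) => h; first lra.
by move=> _; move: Pv; rewrite /v; case: (leP (sup S + r / 2) b) h => //; lra.
Qed.

(** Both measures are restrictions of the same outer measure, so they have the
    same negligible sets. *)
Lemma ae_completedE (R : realType) (P : R -> Prop) :
  {ae lebesgueR R, forall t, P t} <-> {ae @lebesgue_measure R, forall t, P t}.
Proof.
rewrite /prop_near1 /nbhs /= !/(almost_everywhere _).
split.
- move=> [A [mA A0 PA]]; apply/negligible_outer_measure/eqP.
  rewrite eq_le outer_measure_ge0 andbT -[leRHS]A0.
  exact: le_outer_measure.
- move=> /negligible_outer_measure N0.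
  exists (~` [set t | P t]); split => //.
  apply: negligible_sub_caratheodory.
  have /negligible_outer_measure [A [mA A0 PA]] := N0.
  by exists A; split => //; apply: sub_caratheodory.
Qed.

(** * Absolutely continuous functions *)

(** First-order expansion with an explicit neighbourhood. *)
Lemma is_derive_approx (R : realType) (f : R -> R) (x d e : R) :
  is_derive x 1 f d -> 0 < e -> exists2 r, 0 < r & forall y, `|y - x| < r ->
    `|f y - f x - d * (y - x)| <= e * `|y - x|.
Proof.
move=> [df dE] e0; move: df; rewrite /derivable => /cvg_ex[l dfl].
have {}dE : l = d by rewrite -dE; apply/esym/cvg_lim.
rewrite {}dE in dfl.
move/cvgrPdist_le : dfl => /(_ e e0).
rewrite near_withinE => -[r /= r0 rP].
exists r => // y yr.
have [->|yx] := eqVneq y x; first by rewrite !subrr mulr0 subr0 !normr0 mulr0.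
have yx0 : y - x != 0 by rewrite subr_eq0.
have := rP (y - x); rewrite /ball_/= sub0r normrN => /(_ yr yx0).
rewrite [_ *: 1]mulr1 subrK /GRing.scale/= => H.
have -> : f y - f x - d * (y - x) = - ((d - (y - x)^-1 * (f y - f x)) * (y - x)).
  by field.
by rewrite normrN normrM ler_pM2r// normr_gt0.
Qed.

Lemma lipschitz_continuous (R : realType) (f : R -> R) (L : R) :
  (forall s t, `|f s - f t| <= L * `|s - t|) -> continuous f.
Proof.
move=> lf.
have L0 : 0 <= L.
  by have := le_trans (normr_ge0 _) (lf 1 0); rewrite subr0 normr1 mulr1.
move=> t; apply/cvgrPdist_le => e e0.
exists (e / (L + 1)) => /=; first by rewrite divr_gt0// ltr_wpDl.
move=> s /=; rewrite ltr_pdivlMr ?ltr_wpDl// => ts.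
apply: (le_trans (lf _ _)); apply: le_trans (ltW ts).
by rewrite mulrC ler_wpM2l// lerDl.
Qed.

Section absolute_continuity.
Context {R : realType}.
Implicit Types (f g : R -> R) (a b : R).

Lemma absolutely_continuousD a b f g : absolutely_continuous a b f ->
  absolutely_continuous a b g -> absolutely_continuous a b (fun t => f t + g t).
Proof.
move=> cf cg e e0; have e20 : 0 < e / 2 by rewrite divr_gt0.
have [d1 d10 h1] := cf _ e20; have [d2 d20 h2] := cg _ e20.
exists (Num.min d1 d2); first by rewrite lt_min d10.
move=> n x y xy tI; rewrite lt_min => /andP[s1 s2].
have {}h1 := h1 n x y xy tI s1; have {}h2 := h2 n x y xy tI s2.
rewrite [e]splitr; apply: le_lt_trans (ltrD h1 h2).
rewrite -big_split/=; apply: ler_sum => i _.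
by rewrite opprD addrACA ler_normD.
Qed.

Lemma absolutely_continuousN a b f : absolutely_continuous a b f ->
  absolutely_continuous a b (fun t => - f t).
Proof.
move=> cf e /cf[d d0 hd]; exists d => // n x y xy tI /(hd n x y xy tI).
by under eq_bigr do rewrite -normrN opprD.
Qed.

Lemma lipschitz_absolutely_continuous a b f (L : R) :
  (forall s t, a <= s -> s <= t -> t <= b -> `|f t - f s| <= L * (t - s)) ->
  absolutely_continuous a b f.
Proof.
move=> lf e e0; pose M := `|L| + 1.
have M0 : 0 < M by rewrite ltr_wpDl.
exists (e / M); first by rewrite divr_gt0.
move=> n x y xy tI; rewrite ltr_pdivlMr// => /(le_lt_trans _); apply.
rewrite mulr_suml; apply: ler_sum => i _.
have [ax lxy yb] := xy i; apply: (le_trans (lf _ _ ax lxy yb)).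
rewrite mulrC ler_wpM2l ?subr_ge0//.
by rewrite (le_trans (ler_norm _))// lerDl.
Qed.

Lemma absolutely_continuousW a b a' b' f : a <= a' -> b' <= b ->
  absolutely_continuous a b f -> absolutely_continuous a' b' f.
Proof.
move=> aa bb cf e /cf[d d0 h]; exists d => // n x y xy; apply: h => i.
by have [ax lxy yb] := xy i; rewrite (le_trans aa)// (le_trans yb).
Qed.

(** Projection of [t] onto the segment [[a, b]] (for [a <= b]); composition with
    it extends a function on [[a, b]] by constants. *)
Definition clamp a b t : R := Num.max a (Num.min b t).

Lemma clamp_itv a b t : a <= b -> a <= clamp a b t <= b.
Proof. by move=> ab; rewrite /clamp le_max lexx ge_max ab ge_min lexx. Qed.

Lemma clamp_id a b t : a <= t <= b -> clamp a b t = t.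
Proof. by move=> /andP[at_ tb]; rewrite /clamp min_r// max_r. Qed.

Lemma clamp_lipschitz a b s t : s <= t ->
  0 <= clamp a b t - clamp a b s <= t - s.
Proof.
move=> st; rewrite /clamp.
case: (leP b s) => ?; case: (leP b t) => ?.
- by case: (leP a b) => ?; apply/andP; split; lra.
- lra.
- by case: (leP a b) => ?; case: (leP a s) => ?; apply/andP; split; lra.
- by case: (leP a t) => ?; case: (leP a s) => ?; apply/andP; split; lra.
Qed.

Lemma absolutely_continuous_clamp a b f : a <= b -> absolutely_continuous a b f ->
  continuous (f \o clamp a b).
Proof.
move=> ab cf t; apply/cvgrPdist_lt => e e0.
have [d d0 hd] := cf _ e0.
have key u v : a <= u -> u <= v -> v <= b -> v - u < d -> `|f v - f u| < e.
  move=> au uv vb vud; have := hd 1%N (fun=> u) (fun=> v).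
  rewrite !big_ord_recl !big_ord0 !addr0; apply => //.
  by apply/trivIsetP => i j _ _; rewrite !ord1 eqxx.
exists d => // s /=.
have [st|/ltW st] := leP s t.
- have /andP[h1 h2] := clamp_lipschitz a b st.
  rewrite ger0_norm ?subr_ge0// => h3.
  have /andP[h4 _] := clamp_itv s ab.
  have /andP[_ h5] := clamp_itv t ab.
  by apply: key => //; lra.
- have /andP[h1 h2] := clamp_lipschitz a b st.
  rewrite distrC ger0_norm ?subr_ge0// => h3.
  have /andP[h4 _] := clamp_itv t ab.
  have /andP[_ h5] := clamp_itv s ab.
  by rewrite distrC; apply: key => //; lra.
Qed.

(** The role played by the Vitali covering lemma in the usual proof is taken by
    real induction: up to [v], the increment of [f] is at most [e * (v - a)] plus
    the increments over finitely many disjoint intervals inside a small open set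
    [U] that covers the exceptional points. *)
Lemma absolutely_continuous_nonincreasing a b f : a <= b ->
  absolutely_continuous a b f ->
  {ae @lebesgue_measure R, forall t, t \in `[a, b] ->
     exists2 d, d <= 0 & is_derive t 1 f d} ->
  f b <= f a.
Proof.
move=> ab cf; rewrite /prop_near1 /nbhs/= /(almost_everywhere _).
move=> /negligible_outer_measure.
set N := ~` _ => N0.
suff H e : 0 < e -> f b - f a <= e * (b - a) + e.
  apply/ler_addgt0Pr => e e0.
  pose e' := e / (b - a + 1).
  have ba : 0 < b - a + 1 by lra.
  have /H : 0 < e' by rewrite divr_gt0.
  have -> : e' * (b - a) + e' = e by rewrite /e'; field; rewrite gt_eqF.
  by lra.
move=> e0; have [d d0 hd] := cf _ e0.
have d20 : 0 < d / 2 by rewrite divr_gt0.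
have [U [oU NU]] := outer_measure_open_le N d20.
rewrite N0 add0e => muU.
pose P (v : R) := exists (n : nat) (X Y : nat -> R),
  [/\ (forall i, (i < n)%N -> [/\ a <= X i, X i <= Y i & Y i <= v]),
      (forall i, (i < n)%N -> `]X i, Y i[%classic `<=` U),
      (forall i j, (i < j < n)%N -> Y i <= X j) &
      f v - f a <= e * (v - a) + \sum_(i < n) `|f (Y i) - f (X i)| ].
have [n [X [Y [h1 h2 h3 h4]]]] : P b.
  apply: (real_induction ab).
    by exists 0%N, (fun=> 0), (fun=> 0); split => //; rewrite !subrr big_ord0; lra.
  move=> c acb.
  (* near an exceptional point, [u, v] itself is added to the family *)
  have [Nc|Nc] := pselect (N c).
    have [r /= r0 rU] : nbhs c U by apply: open_nbhs_nbhs; split => //; exact: NU.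
    exists r => // u v au vb cu uc cv vr [n [X [Y [h1 h2 h3 h4]]]].
    exists n.+1, (fun i => if i == n then u else X i),
      (fun i => if i == n then v else Y i); split.
    - move=> i; rewrite ltnS leq_eqVlt; case: eqP => [_ _|_ /= /h1[? ? ?]].
        by split => //; lra.
      by split => //; lra.
    - move=> i; rewrite ltnS leq_eqVlt; case: eqP => [_ _|_ /= /h2//].
      move=> z /=; rewrite in_itv/= => /andP[uz zv]; apply: rU => /=.
      by rewrite /ball_/= ltr_norml; apply/andP; split; lra.
    - move=> i j /andP[ij jn].
      have -> : (i == n) = false.
        by apply/negbTE; rewrite neq_ltn (leq_trans ij).
      case: eqP => [jn'|/eqP jn'].
        by have [] := h1 i; rewrite -?jn'.
      by apply: h3; rewrite ij/= ltn_neqAle jn'.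
    - rewrite big_ord_recr/= eqxx.
      have -> : \sum_(i < n) `|f (if i == n :> nat then v else Y i) -
           f (if i == n :> nat then u else X i)| = \sum_(i < n) `|f (Y i) - f (X i)|.
        by apply: eq_bigr => i _; rewrite ltn_eqF.
      have := ler_norm (f v - f u).
      have : 0 <= e * (v - u) by rewrite mulr_ge0; lra.
      lra.
  (* elsewhere the derivative controls the increment and the family is kept *)
  have /contrapT := Nc => /(_ _)[|g g0 dg]; first by rewrite in_itv.
  have [r r0 hr] := is_derive_approx dg e0.
  exists r => // u v au vb cu uc cv vr [n [X [Y [h1 h2 h3 h4]]]].
  exists n, X, Y; split => //.
    by move=> i /h1[? ? ?]; split => //; lra.
  have := hr u; have := hr v.
  have -> : `|v - c| = v - c by rewrite ger0_norm; lra.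
  have -> : `|u - c| = c - u by rewrite distrC ger0_norm; lra.
  move=> /(_ _)/ler_normlP[|_ H1]; first lra.
  move=> /(_ _)/ler_normlP[|H2 _]; first lra.
  have : g * (v - u) <= 0 by rewrite mulr_le0_ge0//; lra.
  lra.
have tI : trivIset setT (fun i : 'I_n => `]X i, Y i[%classic).
  apply/trivIsetP => i j _ _ ij; apply/seteqP; split => // z [] /=.
  rewrite !in_itv/= => /andP[Xi Yi] /andP[Xj Yj].
  have [lij|lij|/val_inj eij] := ltngtP i j.
  - by have := h3 i j; rewrite lij ltn_ord => /(_ isT); lra.
  - by have := h3 j i; rewrite lij ltn_ord => /(_ isT); lra.
  - by rewrite eij eqxx in ij.
apply: (le_trans h4); rewrite lerD2l ltW//; apply: hd => //.
  by move=> i; have [] := h1 i (ltn_ord i).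
suff : \sum_(i < n) (Y i - X i) <= d / 2 by lra.
rewrite -lee_fin; apply: le_trans muU.
rewrite -sumEFin.
have -> : (\sum_(i < n) (Y i - X i)%:E =
    \sum_(i < n) @lebesgue_measure R `]X i, Y i[%classic)%E.
  apply: eq_bigr => i _; rewrite lebesgue_measure_itv/= lte_fin.
  have [_ + _] := h1 i (ltn_ord i).
  by rewrite le_eqVlt => /orP[/eqP ->|->//]; rewrite ltxx subrr.
pose F (i : nat) := if (i < n)%N then `]X i, Y i[%classic else set0.
have mF i : measurable (F i) by rewrite /F; case: ifP.
have tF : trivIset setT F.
  apply/trivIsetP => i j _ _ ij; rewrite /F.
  case: ifPn => [ni|]; rewrite ?set0I//; case: ifPn => [nj|]; rewrite ?setI0//.
  have /trivIsetP/(_ (Ordinal ni) (Ordinal nj) I I) := tI.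
  by apply; apply: contra ij => /eqP[->].
have := measure_bigsetU (@lebesgue_measure R) mF tF n.
rewrite (eq_bigr (fun i : 'I_n => @lebesgue_measure R `]X i, Y i[%classic)); last first.
  by move=> i _; rewrite /F ltn_ord.
move=> <-; apply: le_measure.
- by apply/mem_set; apply: bigsetU_measurable => i _; exact: mF.
- by apply/mem_set; exact: measurable_realfun.open_measurable.
- rewrite -bigcup_mkord => z [i /= ni]; rewrite /F ni; exact: h2.
Qed.

End absolute_continuity.

(** * Primitives of bounded functions *)

(** The almost-everywhere filter, for Lebesgue measure as a bare set function. *)
#[local] Instance ae_lebesgue_filter (R : realType) :
  Filter (almost_everywhere (@lebesgue_measure R)).
Proof. exact: ae_filter_ringOfSetsType. Qed.

Section bounded_functions.
Context {R : realType}.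
Notation mu := (@lebesgue_measure R).
Implicit Types (f g : R -> R) (a b : R).

Lemma bounded_measurable_integrable d (X : measurableType d)
    (m : {measure set X -> \bar R}) (D : set X) (f : X -> R) (M : R) :
  measurable D -> (m D < +oo)%E ->
  measurable_fun D f -> (forall t, D t -> `|f t| <= M) ->
  m.-integrable D (EFin \o f).
Proof.
move=> mD Dfin mf fM; apply: measurable_bounded_integrable => //.
exists M; split => //; first exact: num_real.
by move=> N MN t Dt; apply: le_trans (ltW MN); exact: fM.
Qed.

Lemma itv_integrable a b f (M : R) (x y : bool) : measurable_fun setT f ->
  (forall t, `|f t| <= M) ->
  mu.-integrable [set` Interval (BSide x a) (BSide y b)] (EFin \o f).
Proof.
move=> mf fM.
have fin : (mu [set` Interval (BSide x a) (BSide y b)] < +oo)%E.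
  rewrite lebesgue_measure_itv/=; case: ifP => // _.
  by rewrite -EFinB ltry.
apply: (@bounded_measurable_integrable _ _ _ _ _ M) => //.
exact: measurable_funTS.
Qed.

Lemma primitive_lipschitz a f (M : R) : measurable_fun setT f ->
  (forall t, `|f t| <= M) ->
  let F x := \int[mu]_(t in `[a, x]) f t in
  forall s t, a <= s -> s <= t -> `|F t - F s| <= M * (t - s).
Proof.
move=> mf fM F s t as_ st.
rewrite /F Rintegral_itvB//=; last first.
  exact: itv_integrable fM.
have mfi := itv_integrable s t false false mf fM.
apply: (le_trans (le_normr_Rintegral _ mfi)) => //.
apply: (@le_trans _ _ (\int[mu]_(x in `]s, t]) M)).
  apply: le_Rintegral => //.
  - have h : forall t, `| `|f t| | <= M by move=> ?; rewrite normr_id.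
    by apply: (itv_integrable _ _ _ _ _ h); exact: measurableT_comp.
  - have h : forall t : R, `|M| <= `|M| by [].
    by apply: (itv_integrable _ _ _ _ _ h); exact: measurable_cst.
rewrite Rintegral_cst//= lebesgue_measure_itv/= lte_fin.
move: st; rewrite le_eqVlt => /orP[/eqP ->|->//].
by rewrite ltxx /= subrr.
Qed.

Lemma ae_neq a : {ae mu, forall t, t != a}.
Proof.
exists [set a]; split => //; first exact: lebesgue_measure_set1.
by move=> t /= /negP; rewrite negbK => /eqP.
Qed.

Lemma primitive_derive_ae a f (M : R) : measurable_fun setT f ->
  (forall t, `|f t| <= M) ->
  {ae mu, forall x, a < x ->
    is_derive x 1 (fun x => \int[mu]_(t in `[a, x]) f t) (f x)}.
Proof.
move=> mf fM.
have fi y : mu.-integrable [set` Interval (BLeft a) (BRight y)] (EFin \o f).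
  exact: itv_integrable fM.
have locf : locally_integrable [set: R] f.
  split => //; first exact: openT.
  move=> K _ cK.
  have mK : measurable K := compact_measurable cK.
  have [N [_ NK]] := compact_bounded cK.
  have Kfin : (mu K < +oo)%E.
    apply: (@le_lt_trans _ _ (mu `[- (N + 1), N + 1]%classic)).
      apply: le_measure; rewrite ?inE//.
      move=> x Kx /=; rewrite in_itv/=; have := NK (N + 1) _ x Kx.
      rewrite ltrDl ltr01 => /(_ isT) /=.
      by rewrite ler_norml.
    rewrite lebesgue_measure_itv/=; case: ifP => // _.
    by rewrite -EFinB ltry.
  have /integrableP[_] : mu.-integrable K (EFin \o f).
    apply: (@bounded_measurable_integrable _ _ _ _ _ M) => //.
    exact: measurable_funTS.
  by under eq_integral do rewrite /=.
have := FTC1 fi locf.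
apply: filterS => x /= H ax; have [|d1 d2] := H _; first by rewrite lte_fin.
by split => //; rewrite -derive1E.
Qed.

(** An absolutely continuous function is the primitive of its bounded a.e.
    derivative: the difference with the primitive is absolutely continuous with
    zero derivative a.e. *)
Lemma absolutely_continuous_primitive a b f g (M : R) :
  absolutely_continuous a b f ->
  measurable_fun setT g -> (forall t, `|g t| <= M) ->
  {ae mu, forall t, t \in `[a, b] -> is_derive t 1 f (g t)} ->
  forall t, a <= t <= b -> f t = f a + \int[mu]_(x in `[a, t]) g x.
Proof.
move=> cf mg gM dfg t /andP[at_ tb].
pose G x := \int[mu]_(t in `[a, x]) g t.
have lG := primitive_lipschitz mg gM.
have cG : absolutely_continuous a t G.
  by apply: (@lipschitz_absolutely_continuous _ _ _ _ M) => u v au uv _; exact: lG.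
have cNG := absolutely_continuousN cG.
have {}cf : absolutely_continuous a t f.
  exact: absolutely_continuousW cf.
have cNf := absolutely_continuousN cf.
have dG := primitive_derive_ae a mg gM.
have na := ae_neq a.
have Ga : G a = 0 by rewrite /G set_itv1 Rintegral_set1.
have H1 : f t + - G t <= f a + - G a.
  apply: (absolutely_continuous_nonincreasing at_ (absolutely_continuousD cf cNG)).
  near=> x; rewrite in_itv/= => /andP[ax xt]; exists 0 => //.
  have df : is_derive x 1 f (g x).
    by apply: (near dfg x); rewrite // in_itv/= ax (le_trans xt).
  have xa : x != a by apply: (near na x).
  have dGx : is_derive x 1 G (g x).
    by apply: (near dG x) => //; rewrite lt_neqAle eq_sym xa.
  by rewrite -(subrr (g x)); exact: is_deriveB.
have H2 : - f t + G t <= - f a + G a.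
  apply: (absolutely_continuous_nonincreasing at_ (absolutely_continuousD cNf cG)).
  near=> x; rewrite in_itv/= => /andP[ax xt]; exists 0 => //.
  have df : is_derive x 1 f (g x).
    by apply: (near dfg x); rewrite // in_itv/= ax (le_trans xt).
  have xa : x != a by apply: (near na x).
  have dGx : is_derive x 1 G (g x).
    by apply: (near dG x) => //; rewrite lt_neqAle eq_sym xa.
  by rewrite -(addNr (g x)); apply: is_deriveD.
move: H1 H2; rewrite Ga /G; lra.
Unshelve. all: by end_near. Qed.

(** Conversely, a primitive of a bounded function is absolutely continuous and
    differentiable a.e. (Lebesgue differentiation). *)
Lemma primitive_absolutely_continuous a b f g (M : R) :
  measurable_fun setT g -> (forall t, `|g t| <= M) ->
  (forall t, a <= t <= b -> f t = f a + \int[mu]_(x in `[a, t]) g x) ->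
  absolutely_continuous a b f /\
  {ae mu, forall t, t \in `[a, b] -> is_derive t 1 f (g t)}.
Proof.
move=> mg gM fE; split.
  apply: (@lipschitz_absolutely_continuous _ _ _ _ M) => s t as_ st tb.
  rewrite (fE t) ?(fE s) ?as_ ?(le_trans as_ st) ?(le_trans st tb)//.
  by rewrite opprD addrACA subrr add0r; exact: primitive_lipschitz.
have dG := primitive_derive_ae a mg gM.
have na := ae_neq a; have nb := ae_neq b.
near=> x; rewrite in_itv/= => /andP[ax xb].
have xa : x != a by apply: (near na x).
have xb' : x != b by apply: (near nb x).
have dGx : is_derive x 1 (fun x => \int[mu]_(t in `[a, x]) g t) (g x).
  by apply: (near dG x) => //; rewrite lt_neqAle eq_sym xa.
have dfx : is_derive x 1 (fun x => f a + \int[mu]_(t in `[a, x]) g t) (g x).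
  by rewrite -[g x]add0r; apply: is_deriveD.
apply: near_eq_is_derive dfx.
have : x \in `]a, b[ by rewrite in_itv/= !lt_neqAle eq_sym xa ax xb' xb.
move=> /near_in_itvoo; apply: filterS => y.
by rewrite in_itv/= => /andP[ay yb]; rewrite [RHS]fE// !ltW.
Unshelve. all: by end_near. Qed.

(** A Lipschitz function has a bounded Borel function that coincides with its
    derivative wherever the latter exists. *)
Lemma measurable_derivative f (L : R) :
  (forall s t, `|f s - f t| <= L * `|s - t|) ->
  exists g, [/\ measurable_fun setT g, (forall t, `|g t| <= L) &
    forall t d : R, is_derive t 1 f d -> g t = d].
Proof.
move=> lf.
have L0 : 0 <= L.
  by have := le_trans (normr_ge0 _) (lf 1 0); rewrite subr0 normr1 mulr1.
pose h n t := n.+1%:R * (f (t + n.+1%:R^-1) - f t).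
have hL n t : `|h n t| <= L.
  rewrite /h normrM ger0_norm// mulrC -ler_pdivlMr//.
  by apply: le_trans (lf _ _) _; rewrite addrC addKr ger0_norm.
have cf : continuous f by exact: lipschitz_continuous lf.
have mf : measurable_fun setT f by exact: continuous_measurable_fun.
have mh n : measurable_fun setT (h n).
  apply: measurable_funM => //; apply: measurable_funB => //.
  by apply: measurableT_comp => //; exact: measurable_funD.
have ub t : has_ubound (range (h ^~ t)).
  by exists L => _ [n _ <-]; have := hL n t; rewrite ler_norml => /andP[].
have lb t : has_lbound (range (h ^~ t)).
  by exists (- L) => _ [n _ <-]; have := hL n t; rewrite ler_norml => /andP[].
(* truncated, so that the bound holds everywhere *)
pose g t := Num.max (- L) (Num.min L (limn_sup (h ^~ t))).
exists g; split.
- apply: measurable_maxr => //; apply: measurable_minr => //.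
  by apply: measurable_fun_limn_sup => // t _.
- move=> t; rewrite /g ler_norml le_max lexx /= ge_max ge_min lexx /=.
  by rewrite andbT -subr_ge0 opprK addr_ge0.
- move=> t d dft.
  have hd : h ^~ t @ \oo --> d.
    apply/cvgrPdist_le => e e0.
    have [r r0 hr] := is_derive_approx dft e0.
    near=> n.
    have nr : n.+1%:R^-1 < r by near: n; exact: near_infty_natSinv_lt (PosNum r0).
    have := hr (t + n.+1%:R^-1).
    rewrite (addrC t) addrK ger0_norm// => /(_ nr).
    move=> H; rewrite distrC /h (addrC t).
    have -> : n.+1%:R * (f (n.+1%:R^-1 + t) - f t) - d =
      n.+1%:R * (f (n.+1%:R^-1 + t) - f t - d * n.+1%:R^-1).
      by rewrite [RHS]mulrBr (mulrCA _ d) divff// mulr1.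
    by rewrite normrM ger0_norm// mulrC -ler_pdivlMr.
  have dL : `|d| <= L.
    have -> : d = limn (h ^~ t) by apply/esym/cvg_lim.
    rewrite ler_norml; apply/andP; split.
      apply: limr_ge; first by apply/cvg_ex; exists d.
      by near=> n; have := hL n t; rewrite ler_norml => /andP[].
    apply: limr_le; first by apply/cvg_ex; exists d.
    by near=> n; have := hL n t; rewrite ler_norml => /andP[].
  rewrite /g.
  have -> : limn_sup (h ^~ t) = d by apply/cvg_lim => //; exact: cvg_sups.
  move: dL; rewrite ler_norml => /andP[d1 d2].
  by rewrite min_r// max_r.
Unshelve. all: by end_near. Qed.

End bounded_functions.

(** * Weak limits of bounded sequences of functions *)

(** Along an ultrafilter, every bounded family of reals converges. *)
Lemma ultra_segment_cvg (R : realType) (I : Type) (U : set_system I)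
    (a b : R) (u : I -> R) : UltraFilter U ->
  (forall i, a <= u i <= b) -> exists2 l, a <= l <= b & u x @[x --> U] --> l.
Proof.
move=> UU ab; have PU : ProperFilter U by exact: ultra_proper.
have [|l [/=]] := @segment_compact R a b (fmap u U) _.
  by apply: (@filterE _ U) => i /=; rewrite in_itv/=.
rewrite in_itv/= => lab lcl; exists l => // V Vl.
have [//|UV] := in_ultra_setVsetC (u @^-1` V) UU.
by have [z [/= zV Vz]] := lcl (~` V) V UV Vl.
Qed.

Section weak_limit.
Context d (X : measurableType d) (R : realType).
Variables (m : {sigma_finite_measure set X -> \bar R}) (D : set X)
  (U : set_system nat) (y : nat -> X -> R) (M : R).
Hypotheses (mD : measurable D) (finD : (m D < +oo)%E) (UU : UltraFilter U)
  (my : forall n, measurable_fun setT (y n))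
  (y0M : forall n x, 0 <= y n x <= M).

Let PU : ProperFilter U. Proof. exact: ultra_proper. Qed.

Let I (A : set X) (n : nat) : R := \int[m]_(x in A `&` D) y n x.
Let q (A : set X) : R := fine (m (A `&` D)).

Let fin_q A : measurable A -> (m (A `&` D) < +oo)%E.
Proof.
move=> mA; apply: le_lt_trans finD; apply: le_measure => //.
- by apply/mem_set; exact: measurableI.
- exact: mem_set.
Qed.

Let yI n A : measurable A -> m.-integrable (A `&` D) (EFin \o y n).
Proof.
move=> mA; apply: (@bounded_measurable_integrable _ _ _ _ _ _ M).
- exact: measurableI.
- exact: fin_q.
- exact: measurable_funTS.
- by move=> t _; have /andP[y0 yM] := y0M n t; rewrite ger0_norm.
Qed.

Let I_ge0 A n : 0 <= I A n.
Proof. by apply: Rintegral_ge0 => x _; have /andP[] := y0M n x. Qed.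

Let I_le A n : measurable A -> I A n <= M * q A.
Proof.
move=> mA; rewrite /I /q -Rintegral_cst; last exact: measurableI.
apply: le_Rintegral; first exact: measurableI.
- exact: yI.
- apply: (@bounded_measurable_integrable _ _ _ _ _ _ `|M|) => //.
  + exact: measurableI.
  + exact: fin_q.
- by move=> x _; have /andP[] := y0M n x.
Qed.

Let I_add A B n : measurable A -> measurable B -> A `&` B = set0 ->
  I (A `|` B) n = I A n + I B n.
Proof.
move=> mA mB AB; rewrite /I setIUl Rintegral_setU//.
- exact: measurableI.
- exact: measurableI.
- by rewrite -setIUl; apply: yI; exact: measurableU.
- by apply/disj_setPS; rewrite setIACA AB set0I.
Qed.

(* the limit of the integrals over A, as a function of the set A *)
Let lam A : R := lim (I A n @[n --> U]).

Let lam_cvg A : measurable A -> I A n @[n --> U] --> lam A.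
Proof.
move=> mA; have [l _ hl] := @ultra_segment_cvg R nat U 0 (M * q A) (I A) UU
  (fun n => introT andP (conj (I_ge0 A n) (I_le n mA))).
by apply/cvg_ex; exists l.
Qed.

Let lam_bound A : measurable A -> 0 <= lam A <= M * q A.
Proof.
move=> mA; have [l hlM hl] := @ultra_segment_cvg R nat U 0 (M * q A) (I A) UU
  (fun n => introT andP (conj (I_ge0 A n) (I_le n mA))).
by rewrite /lam (cvg_lim _ hl).
Qed.

Let lam_add A B : measurable A -> measurable B -> A `&` B = set0 ->
  lam (A `|` B) = lam A + lam B.
Proof.
move=> mA mB AB; apply/cvg_lim => //.
have -> : I (A `|` B) = (fun n => I A n + I B n).
  by apply/funext => n; exact: I_add.
by apply: cvgD; exact: lam_cvg.
Qed.

Let lam0 : lam set0 = 0.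
Proof.
have /andP[h1 h2] := lam_bound measurable0.
by apply/eqP; rewrite eq_le h1 andbT (le_trans h2)// /q set0I measure0 mulr0.
Qed.

Let lam_sum (F : nat -> set X) n : (forall i, measurable (F i)) -> trivIset setT F ->
  lam (\big[setU/set0]_(i < n) F i) = \sum_(i < n) lam (F i).
Proof.
move=> mF tF; elim: n => [|n IHn]; first by rewrite !big_ord0.
rewrite !big_ord_recr/= lam_add ?IHn//.
  by apply: bigsetU_measurable => i _.
apply/seteqP; split => // x; rewrite -bigcup_mkord => -[[i /= ni Fi] Fn].
have ni' : i != n by rewrite ltn_eqF.
have /trivIsetP/(_ i n Logic.I Logic.I ni') FF := tF.
by suff : (F i `&` F n) x by rewrite FF.
Qed.

(* nothing is known of lam off the sigma-algebra, where nonnegativity is also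
   required of a measure: the value there is set to 0 *)
Let nu (A : set X) : \bar R := if pselect (measurable A) then (lam A)%:E else 0%E.

Let nuE A : measurable A -> nu A = (lam A)%:E.
Proof. by rewrite /nu; case: pselect. Qed.

Let nu0 : nu set0 = 0%E.
Proof. by rewrite nuE// lam0. Qed.

Let nu_ge0 A : (0 <= nu A)%E.
Proof.
rewrite /nu; case: pselect => // mA; rewrite lee_fin.
by have /andP[] := lam_bound mA.
Qed.

Let nu_sigma_additive : semi_sigma_additive nu.
Proof.
move=> F mF tF mUF; rewrite nuE//.
have -> : (fun n => \sum_(0 <= i < n) nu (F i))%E =
  EFin \o (fun n => lam (\big[setU/set0]_(i < n) F i)).
  apply/funext => n /=; rewrite big_mkord lam_sum// -sumEFin.
  by apply: eq_bigr => i _; rewrite nuE.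
apply: cvg_EFin; first by near=> n.
(* lam is dominated by M times m, whose tails W n vanish in the limit *)
pose W n := \bigcup_i F i `\` \big[setU/set0]_(i < n) F i.
have mbig n : measurable (\big[setU/set0]_(i < n) F i).
  by apply: bigsetU_measurable => i _.
have sub n : \big[setU/set0]_(i < n) F i `<=` \bigcup_i F i.
  by rewrite -bigcup_mkord; apply: bigcup_subset.
have mW n : measurable (W n) by exact: measurableD.
have disjW n : \big[setU/set0]_(i < n) F i `&` W n = set0.
  by rewrite /W setDE setICA setICr setI0.
have lamW n : lam (\big[setU/set0]_(i < n) F i) = lam (\bigcup_i F i) - lam (W n).
  have -> : lam (\bigcup_i F i) = lam (\big[setU/set0]_(i < n) F i) + lam (W n).
    rewrite -lam_add//; first by rewrite setDUK.
  by rewrite addrK.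
have qW n : q (W n) = fine (m ((\bigcup_i F i) `&` D)) -
    fine (m (\big[setU/set0]_(i < n) F i `&` D)).
  rewrite /q.
  have : m ((\bigcup_i F i) `&` D) =
    (m ((\big[setU/set0]_(i < n) F i) `&` D) + m (W n `&` D))%E.
    rewrite -measureU//; try exact: measurableI.
    - by rewrite -setIUl setDUK.
    - by rewrite setIACA disjW set0I.
  move=> ->; rewrite fineD; first by rewrite addrAC subrr add0r.
  - by rewrite ge0_fin_numE//; exact: fin_q.
  - by rewrite ge0_fin_numE//; exact: fin_q.
have qcvg : q (W n) @[n --> \oo] --> 0.
  under eq_fun do rewrite qW.
  rewrite -(subrr (fine (m ((\bigcup_i F i) `&` D)))).
  apply: cvgB; first exact: cvg_cst.
  apply: fine_cvg.
  rewrite fineK; last by rewrite ge0_fin_numE//; exact: fin_q.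
  rewrite setI_bigcupl.
  have mG i : measurable (F i `&` D) by exact: measurableI.
  have tG : trivIset setT (fun i => F i `&` D).
    apply/trivIsetP => i j _ _ ij; rewrite setIACA.
    by move/trivIsetP : tF => /(_ i j Logic.I Logic.I ij) ->; rewrite set0I.
  have -> : (fun n => m (\big[setU/set0]_(i < n) F i `&` D)) =
      (fun n => \sum_(0 <= i < n) m (F i `&` D))%E.
    apply/funext => n; rewrite big_mkord -(measure_bigsetU m mG tG).
    congr (m _); rewrite -(bigcup_mkord n F) setI_bigcupl.
    by rewrite (bigcup_mkord n (fun i => F i `&` D)).
  apply: measure_semi_sigma_additive => //.
  exact: bigcupT_measurable.
have lamW0 : lam (W n) @[n --> \oo] --> 0.
  apply: (@squeeze_cvgr _ _ _ _ (fun=> 0) (fun n => M * q (W n))).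
  - by apply: nearW => n; exact: (lam_bound (mW n)).
  - exact: cvg_cst.
  - by rewrite -(mulr0 M); apply: cvgM => //; exact: cvg_cst.
under eq_fun do rewrite lamW.
suff : lam (\bigcup_i F i) - lam (W n) @[n --> \oo] --> lam (\bigcup_i F i) by [].
rewrite -[X in _ --> X]subr0.
by apply: cvgB lamW0; exact: cvg_cst.
Unshelve. all: by end_near. Qed.

HB.instance Definition _ := isMeasure.Build _ _ _ nu nu0 nu_ge0 nu_sigma_additive.

Let nu_fin : fin_num_fun nu.
Proof. by move=> A mA; rewrite nuE. Qed.

HB.instance Definition _ := Measure_isFinite.Build _ _ _ nu nu_fin.

Let nu_dom : nu `<< m.
Proof.
apply/null_content_dominatesP => A mA A0; rewrite nuE//; congr EFin.
have /andP[h1 h2] := lam_bound mA.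
apply/eqP; rewrite eq_le h1 andbT (le_trans h2)// /q.
suff -> : m (A `&` D) = 0%E by rewrite mulr0.
apply/eqP; rewrite eq_le measure_ge0 andbT -A0; apply: le_measure => //.
- by apply/mem_set; exact: measurableI.
- exact: mem_set.
Qed.

(** Weak compactness of bounded sequences: the limits along [U] of the integrals
    over measurable sets form a finite measure dominated by [m], and the weak
    limit is its density. *)
Lemma bounded_weak_limit : exists z : X -> R,
  [/\ measurable_fun setT z, m.-integrable setT (EFin \o z) &
      forall A, measurable A ->
        \int[m]_(x in A `&` D) y n x @[n --> U] --> \int[m]_(x in A) z x].
Proof.
pose f := Radon_Nikodym_SigmaFinite.f nu m.
have ffin := Radon_Nikodym_SigmaFinite.f_fin_num nu_dom.
have fI := Radon_Nikodym_SigmaFinite.f_integrable nu_dom.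
have fE : EFin \o (fine \o f) = f by apply/funext => x /=; rewrite fineK.
have fI' : m.-integrable setT (EFin \o (fine \o f)) by rewrite fE.
exists (fine \o f); split => //.
  by apply/measurable_EFinP; have /integrableP[] := fI'.
move=> A mA.
have <- : lam A = \int[m]_(x in A) (fine \o f) x; last exact: lam_cvg.
have E : nu A = (\int[m]_(x in A) f x)%E.
  exact: Radon_Nikodym_SigmaFinite.f_integral.
rewrite nuE// in E; rewrite /Rintegral -[LHS]/(fine (lam A)%:E) E.
congr fine; apply: eq_integral => x _.
by rewrite -[RHS]/((EFin \o (fine \o f)) x) fE.
Qed.

End weak_limit.

Section bounded_test.
Import HBSimple.
Context d (X : measurableType d) (R : realType).
Variables (m : {measure set X -> \bar R}) (D : set X)
  (U : set_system nat) (y : nat -> X -> R) (z : X -> R) (M : R).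
Hypotheses (mD : measurable D) (finD : (m D < +oo)%E) (FU : ProperFilter U)
  (my : forall n, measurable_fun setT (y n)) (mz : measurable_fun setT z)
  (y0M : forall n x, 0 <= y n x <= M) (z0M : forall x, 0 <= z x <= M)
  (yz : forall A, measurable A -> A `<=` D ->
    \int[m]_(x in A) y n x @[n --> U] --> \int[m]_(x in A) z x).

(* the test functions for which the conclusion holds *)
Let test (h : X -> R) := [/\ measurable_fun setT h,
  exists B : R, forall x, D x -> `|h x| <= B &
  \int[m]_(x in D) (h x * y n x) @[n --> U] --> \int[m]_(x in D) (h x * z x)].

Let mulI (h w : X -> R) : measurable_fun setT h ->
  (exists B : R, forall x, D x -> `|h x| <= B) -> measurable_fun setT w ->
  (forall x, 0 <= w x <= M) -> m.-integrable D (EFin \o (fun x => h x * w x)).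
Proof.
move=> mh [B hB] mw w0M.
apply: (@bounded_measurable_integrable _ _ _ _ _ _ (B * M)) => //.
  by apply: measurable_funTS; exact: measurable_funM.
move=> x Dx; have /andP[w0 wM] := w0M x.
by rewrite normrM ler_pM// ?hB// ger0_norm.
Qed.

Let test0 : test (fun=> 0).
Proof.
split; [exact: measurable_cst|by exists 0 => x _; rewrite normr0|].
have E w : \int[m]_(x in D) (0 * w x) = 0.
  by under eq_Rintegral do rewrite mul0r; rewrite Rintegral_cst// mul0r.
by rewrite E; under eq_fun do rewrite E; exact: cvg_cst.
Qed.

Let testD h c A : measurable A -> test h -> test (fun x => c * \1_A x + h x).
Proof.
move=> mA [mh [B hB] hc].
have mc : measurable_fun setT (fun x => c * (\1_A x : R)).
  by apply: measurable_funM => //; exact: measurable_indic.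
have bc : exists C : R, forall x, D x -> `|c * (\1_A x : R)| <= C.
  exists `|c| => x _; rewrite normrM -[leRHS]mulr1 ler_wpM2l// indicE.
  by case: (x \in A); rewrite ?normr1 ?normr0.
split.
- exact: measurable_funD.
- have [C hC] := bc; exists (C + B) => x Dx.
  by rewrite (le_trans (ler_normD _ _))// lerD// ?hC ?hB.
have E (w : X -> R) : measurable_fun setT w -> (forall x, 0 <= w x <= M) ->
  \int[m]_(x in D) ((c * \1_A x + h x) * w x) =
  c * \int[m]_(x in D `&` A) w x + \int[m]_(x in D) (h x * w x).
  move=> mw w0M; under eq_Rintegral do rewrite mulrDl.
  rewrite RintegralD//; [|by apply: mulI|by apply: mulI => //; exists B].
  congr (_ + _); under eq_Rintegral do rewrite -mulrA.
  rewrite RintegralZl//.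
    congr (_ * _); rewrite Rintegral_mkcondr; apply: eq_Rintegral => x _.
    by rewrite patchE indicE; case: (x \in A); rewrite ?mul1r ?mul0r.
  apply: mulI => //.
  by exists 1 => x _; rewrite indicE; case: (x \in A); rewrite ?normr1 ?normr0.
rewrite E//; under eq_fun do rewrite E//.
apply: cvgD => //; apply: cvgM; first exact: cvg_cst.
by apply: yz; [exact: measurableI|exact: subIsetl].
Qed.

Let test_sfun (h : {sfun X >-> R}) : test h.
Proof.
have -> : (h : X -> R) = fun x =>
    \sum_(v <- finmap.enum_fset (fset_set (range h))) v * \1_(h @^-1` [set v]) x.
  apply/funext => x; rewrite (fimfunE h) fsbig_finite//.
elim: (finmap.enum_fset _) => [|v s IH].
  by under eq_fun do rewrite big_nil.
under eq_fun do rewrite big_cons.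
by apply: testD.
Qed.

(** Convergence of the integrals over all measurable sets extends to all bounded
    measurable weights, by approximation in mean by simple functions. *)
Lemma weak_cvg_bounded_test (g : X -> R) (G : R) : measurable_fun setT g ->
  (forall x, D x -> `|g x| <= G) ->
  \int[m]_(x in D) (g x * y n x) @[n --> U] --> \int[m]_(x in D) (g x * z x).
Proof.
move=> mg gG; apply/cvgrPdist_le => e e0.
have gI : m.-integrable D (EFin \o g).
  apply: (@bounded_measurable_integrable _ _ _ _ _ _ G) => //.
  exact: measurable_funTS.
have [h_ [hI _ /fine_cvg h0]] := approximation_sfun_integrable mD gI.
pose e' := e / (4 * (`|M| + 1)).
have e'0 : 0 < e' by rewrite divr_gt0// mulr_gt0// ltr_wpDl.
have [N hN] : exists N, \int[m]_(x in D) `|g x - h_ N x| < e'.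
  have /cvgrPdist_lt /(_ _ e'0) [N _ /(_ N (leqnn N))] := h0.
  rewrite /= sub0r normrN => /(le_lt_trans (ler_norm _)) hN; exists N.
  apply: le_lt_trans hN; rewrite le_eqVlt; apply/orP; left; apply/eqP.
  by congr fine; apply: eq_integral => x _.
have [mh [B hB] hc] := test_sfun (h_ N).
have mgh : measurable_fun setT (fun x => g x - h_ N x) by exact: measurable_funB.
have bgh : exists C : R, forall x, D x -> `|g x - h_ N x| <= C.
  by exists (G + B) => x Dx; rewrite (le_trans (ler_normB _ _))// lerD// ?gG ?hB.
have ghI : m.-integrable D (EFin \o (fun x => `|g x - h_ N x|)).
  have [C hC] := bgh.
  apply: (@bounded_measurable_integrable _ _ _ _ _ _ C) => //.
    by apply: measurable_funTS; exact: measurableT_comp.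
  by move=> x Dx; rewrite normr_id hC.
have E (w : X -> R) : measurable_fun setT w -> (forall x, 0 <= w x <= M) ->
    `|\int[m]_(x in D) (g x * w x) - \int[m]_(x in D) (h_ N x * w x)| <= e / 4.
  move=> mw w0M.
  rewrite -RintegralB//; [|by apply: mulI => //; exists G|by apply: mulI => //; exists B].
  under eq_Rintegral do rewrite -mulrBl.
  have ghwI := mulI mgh bgh mw w0M.
  apply: (le_trans (le_normr_Rintegral mD ghwI)).
  apply: (@le_trans _ _ (\int[m]_(x in D) (`|g x - h_ N x| * `|M|))).
    apply: le_Rintegral => //.
    - have [C hC] := bgh.
      apply: (@bounded_measurable_integrable _ _ _ _ _ _ (C * M)) => //.
        apply: measurable_funTS; apply: measurableT_comp => //.
        exact: measurable_funM.
      move=> x Dx; rewrite normr_id normrM; have /andP[w0 wM] := w0M x.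
      by rewrite ler_pM// ?hC// ger0_norm.
    - have [C hC] := bgh.
      apply: (@bounded_measurable_integrable _ _ _ _ _ _ (C * `|M|)) => //.
        apply: measurable_funTS; apply: measurable_funM => //.
        exact: measurableT_comp.
      by move=> x Dx; rewrite normrM !normr_id ler_wpM2r// hC.
    - move=> x _; have /andP[w0 wM] := w0M x.
      rewrite normrM ler_wpM2l// ger0_norm//.
      by rewrite (le_trans wM)// ler_norm.
  rewrite RintegralZr//.
  apply: (@le_trans _ _ (e' * `|M|)); first by rewrite ler_wpM2r// ltW.
  rewrite /e' -mulrA ler_pM2l// invfM -mulrA ler_piMr//.
  by rewrite mulrC ler_pdivrMr ?ltr_wpDl// mul1r lerDl.
have e20 : 0 < e / 2 by rewrite divr_gt0.
move/cvgrPdist_le : hc => /(_ _ e20); apply: filterS => n /= H.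
have H1 := E _ (my n) (y0M n); have H2 := E _ mz z0M.
move: H H1 H2 => /ler_normlP[h1 h2] /ler_normlP[h3 h4] /ler_normlP[h5 h6].
apply/ler_normlP; split; lra.
Qed.

End bounded_test.

(** * Uniformity on segments and concavity *)

(** On a segment, pointwise convergence of equi-Lipschitz functions is uniform,
    along any filter. *)
Lemma lipschitz_cvg_uniform (R : realType) (I : Type) (U : set_system I)
    (a b L : R) (k : I -> R -> R) (l : R -> R) : Filter U -> a <= b ->
  (forall i s t, `|k i s - k i t| <= L * `|s - t|) ->
  (forall s t, `|l s - l t| <= L * `|s - t|) ->
  (forall t, k i t @[i --> U] --> l t) ->
  forall e, 0 < e -> \forall i \near U, forall t, a <= t <= b -> `|k i t - l t| <= e.
Proof.
move=> FU ab kL lL kl e e0.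
have pw t r : 0 < r -> \forall i \near U, `|k i t - l t| <= r.
  move=> r0; have /cvgrPdist_le /(_ r r0) := kl t.
  by apply: filterS => i; rewrite distrC.
pose P v := \forall i \near U, forall t, a <= t <= v -> `|k i t - l t| <= e.
apply: (@real_induction _ a b P) => //.
  apply: filterS (pw a e e0) => i h t.
  by rewrite -eq_le => /eqP <-.
move=> c acb.
have L0 : 0 <= L.
  by have := le_trans (normr_ge0 _) (lL 1 0); rewrite subr0 normr1 mulr1.
have L1 : 0 < L + 1 by lra.
pose r := e / (3 * (L + 1)).
have r0 : 0 < r by rewrite divr_gt0// mulr_gt0.
have Lr : L * r <= e / 3.
  have -> : e / 3 = (L + 1) * r by rewrite /r; field; rewrite gt_eqF.
  by rewrite ler_wpM2r ?(ltW r0)//; lra.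
exists r => // u v au vb cu uc cv vr.
have e30 : 0 < e / 3 by lra.
apply: filterS2 (pw c _ e30) => i hc hu t /andP[at_ tv].
have [tu|ut] := leP t u; first by apply: hu; rewrite at_.
have tc : `|t - c| <= r by rewrite ler_norml; apply/andP; split; lra.
have h1 : `|k i t - k i c| <= e / 3.
  by apply: (le_trans (kL i t c)); apply: le_trans Lr; rewrite ler_wpM2l.
have h2 : `|l t - l c| <= e / 3.
  by apply: (le_trans (lL t c)); apply: le_trans Lr; rewrite ler_wpM2l.
move: h1 h2 hc => /ler_normlP[? ?] /ler_normlP[? ?] /ler_normlP[? ?].
by apply/ler_normlP; split; lra.
Qed.

Lemma segment_uniform_continuous (R : realType) (a b : R) (f : R -> R) : a <= b ->
  continuous f -> forall e, 0 < e -> exists2 d, 0 < d &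
    forall x y, a <= x <= b -> a <= y <= b -> `|x - y| <= d -> `|f x - f y| <= e.
Proof.
move=> ab cf e e0.
pose P v := exists2 d, 0 < d &
  forall x y, a <= x <= v -> a <= y <= v -> `|x - y| <= d -> `|f x - f y| <= e.
apply: (@real_induction _ a b P) => //.
  exists 1 => // x y; rewrite -!eq_le => /eqP <- /eqP <- _.
  by rewrite subrr normr0 ltW.
move=> c acb.
have e20 : 0 < e / 2 by lra.
have /cvgrPdist_le /(_ _ e20) [r /= r0 hr] := cf c.
exists (r / 2); first by lra.
move=> u v au vb cu uc cv vr [d d0 hd].
exists (Num.min d (r / 3)); first by rewrite lt_min d0/=; lra.
move=> x y /andP[ax xv] /andP[ay yv]; rewrite le_min => /andP[xyd xyr].
have [/andP[xu yu]|] := boolP ((x <= u) && (y <= u)).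
  by apply: hd => //; rewrite ?ax ?ay.
rewrite negb_and -!ltNge => xyu.
have [h1 h2] : `|c - x| < r /\ `|c - y| < r.
  move: xyr => /ler_normlP[? ?].
  by split; apply/ltr_normlP; move: xyu => /orP[?|?]; split; lra.
have := hr _ h1; have := hr _ h2.
move=> /ler_normlP[? ?] /ler_normlP[? ?].
by apply/ler_normlP; split; lra.
Qed.

Lemma segment_bounded (R : realType) (a b : R) (f : R -> R) : a <= b ->
  continuous f -> exists B : R, forall x, a <= x <= b -> `|f x| <= B.
Proof.
move=> ab cf.
have [|c _ hc] := @EVT_max _ (fun x => `|f x|) _ _ ab.
  apply: continuous_subspaceT => x.
  by apply: continuous_comp; [exact: cf|exact: norm_continuous].
by exists `|f c| => x xab; apply: hc; rewrite in_itv.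
Qed.

Section concave.
Context {R : realType}.
Variable w : R -> R.
Hypothesis cw : concave_function `[0, +oo[ w.

(** Concavity in the form of the three-chord inequality, without quotients. *)
Lemma concave_chord (a b c : R) : 0 <= a -> a <= b -> b <= c ->
  w a * (c - b) + w c * (b - a) <= w b * (c - a).
Proof.
move=> a0 ab bc.
have [ac|ac] := eqVneq a c.
  have -> : b = a by apply/eqP; rewrite eq_le ab ac bc.
  by rewrite ac !subrr !mulr0 addr0.
have ca0 : 0 < c - a by rewrite subr_gt0 lt_neqAle ac (le_trans ab).
pose t : R := (c - b) / (c - a).
have t0 : 0 <= t by rewrite /t divr_ge0//; lra.
have t1 : t <= 1 by rewrite /t ler_pdivrMr//; lra.
have ha : a \in (`[0, +oo[%classic : set R) by rewrite inE/= in_itv/= a0.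
have hc : c \in (`[0, +oo[%classic : set R).
  by rewrite inE/= in_itv/= andbT; lra.
have := @cw (Itv01 t0 t1) a c ha hc.
rewrite !convRE/= /unstable.onem.
rewrite [X in - w X](_ : _ = b); last first.
  transitivity (t * a + (1 - t) * c); first by [].
  by rewrite /t; field; rewrite gt_eqF.
have tca : t * (c - a) = c - b by rewrite /t; field; rewrite gt_eqF.
have -> : b - a = (1 - t) * (c - a) by rewrite mulrBl mul1r tca; ring.
rewrite -tca => H.
have {}H : t * w a + (1 - t) * w c <= w b by lra.
have -> : w a * (t * (c - a)) + w c * ((1 - t) * (c - a)) =
  (t * w a + (1 - t) * w c) * (c - a) by ring.
by rewrite ler_pM2r.
Qed.

(** A secant line through two points at distance [e] bounds a concave function
    from above, up to twice its oscillation [eta] at scale [e]. Unlike that of a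
    supporting line, the slope stays bounded near [0] and is an explicit function
    of the base point, which makes it measurable along a measurable function. *)
Lemma concave_le_secant (C e eta : R) : 0 < e ->
  (forall x y, 0 <= x <= C + e -> 0 <= y <= C + e -> `|x - y| <= e ->
     `|w x - w y| <= eta) ->
  forall x u, 0 <= x <= C -> 0 <= u <= C ->
    w u <= w x + (w (x + e) - w x) / e * (u - x) + 2 * eta.
Proof.
move=> e0 osc x u /andP[x0 xC] /andP[u0 uC].
have /ler_normlP[ osc1 osc2] : `|w (x + e) - w x| <= eta.
  apply: osc; try (apply/andP; split; lra).
  by rewrite (addrC x) addrK gtr0_norm.
have eta0 : 0 <= eta by lra.
set p := (w (x + e) - w x) / e.
have wxe : w (x + e) = w x + p * e by rewrite /p; field; rewrite gt_eqF.
rewrite wxe in osc1 osc2.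
have scaled : e * (w u - w x - p * (u - x)) <= 0 ->
    w u <= w x + p * (u - x) + 2 * eta.
  by rewrite pmulr_rle0//; lra.
have [ux|xu] := leP u x.
  have xxe : x <= x + e by lra.
  apply: scaled; have := concave_chord u0 ux xxe; rewrite wxe => H.
  have -> : e * (w u - w x - p * (u - x)) =
    w u * (x + e - x) + (w x + p * e) * (x - u) - w x * (x + e - u) by ring.
  by rewrite subr_le0.
have [xeu|uxe] := leP (x + e) u.
  have xxe : x <= x + e by lra.
  apply: scaled; have := concave_chord x0 xxe xeu; rewrite wxe => H.
  have -> : e * (w u - w x - p * (u - x)) =
    w x * (u - (x + e)) + w u * (x + e - x) - (w x + p * e) * (u - x) by ring.
  by rewrite subr_le0.
have /ler_normlP[h1 h2] : `|w u - w x| <= eta.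
  apply: osc; try (apply/andP; split; lra).
  by rewrite ger0_norm; lra.
have : - eta <= p * (u - x).
  have [p0|p0] := leP 0 p.
    have : 0 <= p * (u - x) by rewrite mulr_ge0//; lra.
    by lra.
  have : p * e <= p * (u - x) by rewrite ler_nM2l//; lra.
  by lra.
by lra.
Qed.

End concave.

(** * Limits and minima under the integral *)

Section integral_lemmas.
Context d (X : measurableType d) (R : realType) (m : {measure set X -> \bar R}).

Lemma uniform_cvg_Rintegral (I : Type) (U : set_system I) (D : set X)
    (f_ : I -> X -> R) (f : X -> R) : Filter U ->
  measurable D -> (m D < +oo)%E ->
  (forall i, m.-integrable D (EFin \o f_ i)) -> m.-integrable D (EFin \o f) ->
  (forall e, 0 < e -> \forall i \near U, forall x, D x -> `|f_ i x - f x| <= e) ->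
  \int[m]_(x in D) f_ i x @[i --> U] --> \int[m]_(x in D) f x.
Proof.
move=> FU mD Dfin If_ If uf; apply/cvgrPdist_le => e e0.
pose M := fine (m D) + 1.
have M0 : 0 < M by rewrite ltr_wpDl// fine_ge0.
have eM0 : 0 < e / M by rewrite divr_gt0.
apply: filterS (uf _ eM0) => i hi.
rewrite distrC -RintegralB//.
have Id : m.-integrable D (EFin \o (fun x => f_ i x - f x)).
  exact: (@integrableB _ _ _ m D mD (EFin \o f_ i) (EFin \o f)).
apply: (le_trans (le_normr_Rintegral mD Id)).
apply: (@le_trans _ _ (\int[m]_(x in D) (e / M))).
  apply: le_Rintegral => //.
    have : m.-integrable D (abse \o (EFin \o (fun x => f_ i x - f x))).
      exact: integrable_abse.
    by congr (_.-integrable _ _).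
  apply: (@bounded_measurable_integrable _ _ _ _ _ _ (e / M)) => //.
  by move=> t _; rewrite gtr0_norm.
rewrite Rintegral_cst// mulrAC ler_pdivrMr// ler_wpM2l// ?(ltW e0)//.
by rewrite lerDl.
Qed.

Lemma integrable_min (D : set X) (f g : X -> R) : measurable D ->
  measurable_fun setT f -> measurable_fun setT g ->
  m.-integrable D (EFin \o f) -> m.-integrable D (EFin \o g) ->
  m.-integrable D (EFin \o (fun x => Num.min (f x) (g x))).
Proof.
move=> mD mf mg If Ig.
apply: (le_integrable mD _ _ (integrableD mD (integrable_abse If) (integrable_abse Ig))).
  by apply/measurable_EFinP; apply: measurable_funTS; exact: measurable_minr.
move=> x Dx /=; rewrite lee_fin [leRHS]ger0_norm ?addr_ge0//.
by case: (leP (f x) (g x)) => _; rewrite ?lerDl ?lerDr.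
Qed.

(** If [f <= g] holds in the mean over every measurable subset of [D], then
    truncating [f] at [g] changes none of its integrals. *)
Lemma Rintegral_min (D : set X) (f g : X -> R) : measurable D ->
  measurable_fun setT f -> measurable_fun setT g ->
  m.-integrable D (EFin \o f) -> m.-integrable D (EFin \o g) ->
  (forall A, measurable A -> A `<=` D ->
     \int[m]_(x in A) f x <= \int[m]_(x in A) g x) ->
  forall A, measurable A -> A `<=` D ->
    \int[m]_(x in A) Num.min (f x) (g x) = \int[m]_(x in A) f x.
Proof.
move=> mD mf mg If Ig fg A mA AD.
pose B := [set x | g x < f x].
have mB : measurable B.
  rewrite (_ : B = (f \- g) @^-1` `]0, +oo[%classic).
    rewrite -[X in measurable X]setTI; apply: measurable_funB => //.
  by apply/seteqP; split => x; rewrite /B /= in_itv/= andbT subr_gt0.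
have mAB : measurable (A `&` B) by exact: measurableI.
have mAB' : measurable (A `\` B) by exact: measurableD.
have ABD : A `&` B `<=` D by move=> x [/AD].
have ABD' : A `\` B `<=` D by move=> x [/AD].
have Imin : m.-integrable A (EFin \o (fun x => Num.min (f x) (g x))).
  exact: (integrableS mD mA AD (integrable_min mD mf mg If Ig)).
have AE : A = (A `&` B) `|` (A `\` B) by rewrite setUIDK.
have dAB : [disjoint A `&` B & A `\` B].
  by apply/disj_setPS => x [[_ Bx] [_ /(_ Bx)]].
have IfA : m.-integrable A (EFin \o f) by exact: (integrableS mD mA AD).
rewrite AE Rintegral_setU//=; [|by rewrite -AE].
rewrite [RHS]Rintegral_setU//=; [|by rewrite -AE].
congr (_ + _); last first.
  apply: eq_Rintegral => x /set_mem[_ /negP]; rewrite -leNgt => h.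
  by rewrite min_l.
have -> : \int[m]_(x in A `&` B) Num.min (f x) (g x) = \int[m]_(x in A `&` B) g x.
  apply: eq_Rintegral => x /set_mem[_ h].
  by rewrite min_r// ltW.
apply/eqP; rewrite eq_le fg// andbT; apply: le_Rintegral => //.
- exact: (integrableS mD mAB ABD).
- exact: (integrableS mD mAB ABD).
- by move=> x [_ /ltW].
Qed.

End integral_lemmas.

(** * The problem in terms of the investment rate *)

Section reduced_problem.
Context {R : realType}.
Notation mu := (@lebesgue_measure R).
Variables (w phi : R -> R) (t0 T lambda sigma k0 K L Phi : R).

(** A state [k] together with the investment rate [y = s * phi k] that drives it.
    The state equation is in integral form, and only on [[t0, T]]; the other
    conditions are imposed at all real times, the state being thought of as
    extended by constants. The bound [K] and the Lipschitz constant [L] are part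
    of the definition, which makes the set of processes compact. *)
Record reduced_process (k y : R -> R) : Prop := ReducedProcess {
  reduced_lipschitz : forall s t, `|k s - k t| <= L * `|s - t| ;
  reduced_range : forall t, 0 <= k t <= K ;
  reduced_measurable : measurable_fun setT y ;
  reduced_control : forall t, 0 <= y t <= phi (k t) ;
  reduced_state : forall t, t0 <= t <= T ->
    k t = k0 + \int[mu]_(x in `[t0, t]) (y x - sigma * k x)
}.

(** The objective as a function of the state and of the investment rate; the
    consumption is [phi k - y]. *)
Definition reward (k y : R -> R) : R :=
  \int[mu]_(x in `[t0, T]) (w (phi (k x) - y x) * expR (- lambda * x)).

Hypotheses (ht0 : 0 <= t0) (hT : t0 < T) (hlambda : 0 <= lambda)
  (cphi : continuous phi) (cw : continuous w)
  (phiP : forall x, 0 <= x <= K -> 0 <= phi x <= Phi)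
  (concw : concave_function `[0, +oo[ w).

Let D : set R := `[t0, T]%classic.
Let mD : measurable D. Proof. exact: measurable_itv. Qed.
Let muD : mu D = (T - t0)%:E.
Proof. by rewrite /D lebesgue_measure_itv/= lte_fin hT -EFinB. Qed.
Let finD : (mu D < +oo)%E. Proof. by rewrite muD ltry. Qed.

Let D_integrable (A : set R) (f : R -> R) (B : R) : measurable A -> A `<=` D ->
  measurable_fun setT f -> (forall x, t0 <= x <= T -> `|f x| <= B) ->
  mu.-integrable A (EFin \o f).
Proof.
move=> mA AD mf fB.
have finA : (mu A < +oo)%E.
  by apply: le_lt_trans finD; apply: le_measure => //; exact/mem_set.
apply: (@bounded_measurable_integrable _ _ _ _ _ _ B) => //.
  exact: measurable_funTS.
by move=> x /AD; rewrite /D/= in_itv/=; exact: fB.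
Qed.

Let rho x := expR (- lambda * x).
Let mrho : measurable_fun setT rho.
Proof. by apply: measurableT_comp => //; exact: measurable_funM. Qed.
Let rho0 x : 0 <= rho x. Proof. exact: expR_ge0. Qed.
Let rho1 x : t0 <= x <= T -> rho x <= 1.
Proof.
move=> /andP[tx _]; rewrite /rho -expR0 ler_expR mulNr oppr_le0.
by rewrite mulr_ge0// (le_trans ht0).
Qed.

Let mphi : measurable_fun setT phi. Proof. exact: continuous_measurable_fun. Qed.
Let mw : measurable_fun setT w. Proof. exact: continuous_measurable_fun. Qed.

Section process.
Variables (k y : R -> R).
Hypothesis ky : reduced_process k y.

Let ck : continuous k.
Proof. exact: lipschitz_continuous (reduced_lipschitz ky). Qed.

Let mk : measurable_fun setT k. Proof. exact: continuous_measurable_fun. Qed.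

Let c x := phi (k x) - y x.

Lemma consumption_range x : 0 <= c x <= Phi.
Proof.
have /andP[y0 yp] := reduced_control ky x.
have /andP[_ pP] := phiP (reduced_range ky x).
by apply/andP; split; rewrite /c; lra.
Qed.

Lemma measurable_production : measurable_fun setT (fun x => phi (k x)).
Proof. exact: measurableT_comp. Qed.

Lemma measurable_state : measurable_fun setT k. Proof. exact: mk. Qed.

Lemma measurable_consumption : measurable_fun setT c.
Proof.
apply: measurable_funB; first exact: measurable_production.
exact: reduced_measurable ky.
Qed.

Lemma measurable_reward : measurable_fun setT (fun x => w (c x) * rho x).
Proof.
apply: measurable_funM => //; apply: measurableT_comp => //.
exact: measurable_consumption.
Qed.

Lemma reward_bound (B : R) : (forall x, 0 <= x <= Phi -> `|w x| <= B) ->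
  forall x, t0 <= x <= T -> `|w (c x) * rho x| <= B.
Proof.
move=> wB x xT; rewrite normrM (ger0_norm (rho0 x)) -[B]mulr1.
by apply: ler_pM => //; [exact: wB (consumption_range x)|exact: rho1].
Qed.

Lemma reward_integrable (B : R) : (forall x, 0 <= x <= Phi -> `|w x| <= B) ->
  mu.-integrable D (EFin \o (fun x => w (c x) * rho x)).
Proof.
by move=> wB; apply: (@D_integrable _ _ B) => //; [exact: measurable_reward|exact: reward_bound].
Qed.

Lemma reward_le (B : R) : (forall x, 0 <= x <= Phi -> `|w x| <= B) ->
  reward k y <= B * (T - t0).
Proof.
move=> wB; rewrite /reward -/D.
apply: (@le_trans _ _ (\int[mu]_(x in D) B)).
  apply: le_Rintegral => //; first exact: reward_integrable wB.
    by apply: (@D_integrable _ _ `|B|) => //; exact: measurable_cst.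
  move=> x; rewrite /D/= in_itv/= => xT.
  exact: le_trans (ler_norm _) (reward_bound wB xT).
by rewrite Rintegral_cst// -[X in _ * X <= _]/(fine (mu D)) muD.
Qed.

End process.

Section maximizing.
Variables (k_ y_ : nat -> R -> R).
Hypothesis kyP : forall n, reduced_process (k_ n) (y_ n).
Variable U : set_system nat.
Hypothesis UU : UltraFilter U.

Let PU : ProperFilter U. Proof. exact: ultra_proper. Qed.
Let FU : Filter U. Proof. exact: _. Qed.

Let K_ n t := reduced_range (kyP n) t.

(** The ultrafilter limit of the states satisfies the same bounds. *)
Lemma state_limit : exists k : R -> R,
  [/\ forall t, k_ n t @[n --> U] --> k t,
    forall s t, `|k s - k t| <= L * `|s - t| &
    forall t, 0 <= k t <= K].
Proof.
have ex t := ultra_segment_cvg UU (fun n => K_ n t).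
pose k t := projT1 (cid2 (ex t)).
have kK t : 0 <= k t <= K by rewrite /k; case: cid2.
have kU t : k_ n t @[n --> U] --> k t by rewrite /k; case: cid2.
exists k; split => // s t.
have H : `|k_ n s - k_ n t| @[n --> U] --> `|k s - k t|.
  by apply: cvg_norm; apply: cvgB.
rewrite -(cvg_lim _ H)//; apply: limr_le; first by apply/cvg_ex; eexists; exact: H.
by apply: nearW => n; exact: (reduced_lipschitz (kyP n)).
Qed.


Variable k : R -> R.
Hypotheses (kU : forall t, k_ n t @[n --> U] --> k t)
  (kL : forall s t, `|k s - k t| <= L * `|s - t|)
  (kK : forall t, 0 <= k t <= K).

Let mk : measurable_fun setT k.
Proof. exact: continuous_measurable_fun (lipschitz_continuous kL). Qed.

Let mpk : measurable_fun setT (fun x => phi (k x)).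
Proof. exact: measurableT_comp. Qed.

Let K0 : 0 <= K.
Proof. by have /andP[] := kK 0; exact: le_trans. Qed.

Let phin n x : 0 <= phi (k_ n x) <= Phi. Proof. by apply: phiP; exact: K_. Qed.
Let phik x : 0 <= phi (k x) <= Phi. Proof. by apply: phiP; exact: kK. Qed.

Let y_Phi n x : 0 <= y_ n x <= Phi.
Proof.
have /andP[y0 yp] := reduced_control (kyP n) x.
by have /andP[_] := phin n x; rewrite y0; exact: le_trans.
Qed.

Lemma state_uniform (e : R) : 0 < e ->
  \forall n \near U, forall t, D t -> `|k_ n t - k t| <= e.
Proof.
move=> e0; have := lipschitz_cvg_uniform FU (ltW hT)
  (fun n => reduced_lipschitz (kyP n)) kL kU e0.
by apply: filterS => n hn t; rewrite /D/= in_itv/=; exact: hn.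
Qed.

Lemma production_uniform (e : R) : 0 < e ->
  \forall n \near U, forall t, D t -> `|phi (k_ n t) - phi (k t)| <= e.
Proof.
move=> e0; have [d d0 hd] := segment_uniform_continuous K0 cphi e0.
apply: filterS (state_uniform d0) => n hn t Dt.
by apply: hd; [exact: K_|exact: kK|exact: hn].
Qed.

Let mphin n : measurable_fun setT (fun x => phi (k_ n x)).
Proof. exact: measurable_production (kyP n). Qed.

Let subDfin A : measurable A -> A `<=` D -> (mu A < +oo)%E.
Proof.
by move=> mA AD; apply: le_lt_trans finD; apply: le_measure => //; exact/mem_set.
Qed.

(** The weak limit of the rates, modified on a null set so that the constraint
    [0 <= z <= phi k] holds everywhere. *)
Lemma control_limit : exists z : R -> R,
  [/\ measurable_fun setT z, forall t, 0 <= z t <= phi (k t) &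
    forall A, measurable A -> A `<=` D ->
      \int[mu]_(x in A) y_ n x @[n --> U] --> \int[mu]_(x in A) z x].
Proof.
have [z0 [mz0 Iz0 hz0]] := @bounded_weak_limit _ _ _ (@lebesgue_measure R)
  D U y_ Phi mD finD UU (fun n => reduced_measurable (kyP n)) y_Phi.
have Iz0D : mu.-integrable D (EFin \o z0) by exact: integrableS Iz0.
have I0 : mu.-integrable D (EFin \o (fun=> 0 : R)).
  apply: (@D_integrable _ _ 0) => //.
  by move=> x _; rewrite normr0.
have lim0 A : measurable A -> A `<=` D ->
    \int[mu]_(x in A) y_ n x @[n --> U] --> \int[mu]_(x in A) z0 x.
  by move=> mA AD; have := hz0 _ mA; rewrite setIidl.
have Iy n A : measurable A -> A `<=` D -> mu.-integrable A (EFin \o y_ n).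
  move=> mA AD; apply: (@D_integrable _ _ Phi) => //; first exact: reduced_measurable (kyP n).
  by move=> x _; have /andP[h1 h2] := y_Phi n x; rewrite ger0_norm.
have Ipn n A : measurable A -> A `<=` D ->
    mu.-integrable A (EFin \o (fun x => phi (k_ n x))).
  move=> mA AD; apply: (@D_integrable _ _ Phi) => //.
  by move=> x _; have /andP[h1 h2] := phin n x; rewrite ger0_norm.
have Ipk A : measurable A -> A `<=` D ->
    mu.-integrable A (EFin \o (fun x => phi (k x))).
  move=> mA AD; apply: (@D_integrable _ _ Phi) => //.
  by move=> x _; have /andP[h1 h2] := phik x; rewrite ger0_norm.
(* z1 is the positive part of the weak limit z0 *)
pose z1 x := z0 x - Num.min 0 (z0 x).
have mz1 : measurable_fun setT z1.
  by apply: measurable_funB => //; apply: measurable_minr.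
have min0 A : measurable A -> A `<=` D ->
    \int[mu]_(x in A) Num.min 0 (z0 x) = 0.
  move=> mA AD.
  transitivity (\int[mu]_(x in A) (fun=> 0 : R) x); last first.
    by rewrite Rintegral_cst// mul0r.
  apply: (@Rintegral_min _ _ _ mu D (fun=> 0) z0) => // B mB BD.
  rewrite Rintegral_cst// mul0r.
  rewrite -(cvg_lim _ (lim0 _ mB BD))//; apply: limr_ge.
    by apply/cvg_ex; eexists; exact: lim0.
  apply: nearW => n; apply: Rintegral_ge0 => x _.
  by have /andP[] := y_Phi n x.
have Imin : mu.-integrable D (EFin \o (fun x => Num.min 0 (z0 x))).
  by apply: integrable_min.
have Iz1 : mu.-integrable D (EFin \o z1).
  exact: (@integrableB _ _ _ mu D mD (EFin \o z0) (EFin \o (fun x => Num.min 0 (z0 x)))).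
have z1z0 A : measurable A -> A `<=` D ->
    \int[mu]_(x in A) z1 x = \int[mu]_(x in A) z0 x.
  move=> mA AD; rewrite /z1 RintegralB//.
  - by rewrite min0// subr0.
  - exact: integrableS Iz0D.
  - exact: integrableS Imin.
pose z x := Num.min (z1 x) (phi (k x)).
exists z; split.
- exact: measurable_minr.
- move=> t; rewrite /z le_min ge_min lexx orbT andbT.
  have /andP[-> _] := phik t; rewrite andbT /z1.
  by case: (leP 0 (z0 t)) => h; rewrite ?subr0// subrr.
- move=> A mA AD.
  have -> : \int[mu]_(x in A) z x = \int[mu]_(x in A) z1 x.
    apply: (@Rintegral_min _ _ _ mu D z1 (fun x => phi (k x))) => //.
      exact: Ipk.
    move=> B mB BD; rewrite z1z0//.
    have pcvg : \int[mu]_(x in B) phi (k_ n x) @[n --> U] -->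
        \int[mu]_(x in B) phi (k x).
      apply: uniform_cvg_Rintegral => //.
      * exact: subDfin.
      * by move=> n; exact: Ipn.
      * exact: Ipk.
      * by move=> e e0; apply: filterS (production_uniform e0) => n hn x /BD; exact: hn.
    rewrite -(cvg_lim _ (lim0 _ mB BD))// -(cvg_lim _ pcvg)//.
    apply: ler_lim.
    * by apply/cvg_ex; eexists; exact: lim0.
    * by apply/cvg_ex; eexists; exact: pcvg.
    * apply: nearW => n; apply: le_Rintegral => //; [exact: Iy|exact: Ipn|].
      by move=> x _; have /andP[] := reduced_control (kyP n) x.
  rewrite z1z0//; exact: lim0.
Qed.

Variable z : R -> R.
Hypotheses (mz : measurable_fun setT z) (zk : forall t, 0 <= z t <= phi (k t))
  (yz : forall A, measurable A -> A `<=` D ->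
      \int[mu]_(x in A) y_ n x @[n --> U] --> \int[mu]_(x in A) z x).

Lemma process_limit : reduced_process k z.
Proof.
split => // t tT; pose A : set R := `[t0, t]%classic.
have mA : measurable A by exact: measurable_itv.
have AD : A `<=` D.
  move=> x; rewrite /A /D/= !in_itv/= => /andP[-> /le_trans]; apply.
  by have /andP[] := tT.
have Ik n : mu.-integrable A (EFin \o k_ n).
  apply: (@D_integrable _ _ K) => //; first exact: measurable_state (kyP n).
  by move=> x _; have /andP[h1 h2] := K_ n x; rewrite ger0_norm.
have Ikk : mu.-integrable A (EFin \o k).
  by apply: (@D_integrable _ _ K) => // x _; have /andP[h1 h2] := kK x; rewrite ger0_norm.
have E (f g : R -> R) (M : R) : measurable_fun setT f -> (forall x, 0 <= f x <= M) ->
    measurable_fun setT g -> (forall x, 0 <= g x <= K) ->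
    \int[mu]_(x in A) (f x - sigma * g x) =
    \int[mu]_(x in A) f x - sigma * \int[mu]_(x in A) g x.
  move=> mf fM mg gK.
  rewrite RintegralB//.
  - rewrite RintegralZl//.
    by apply: (@D_integrable _ _ K) => // x _; have /andP[h1 h2] := gK x; rewrite ger0_norm.
  - by apply: (@D_integrable _ _ M) => // x _; have /andP[h1 h2] := fM x; rewrite ger0_norm.
  - apply: (@D_integrable _ _ (`|sigma| * K)) => //; first exact: measurable_funM.
    move=> x _; have /andP[h1 h2] := gK x.
    by rewrite normrM ler_wpM2l// ger0_norm.
have z_Phi x : 0 <= z x <= Phi.
  have /andP[z0 zp] := zk x; have /andP[_ pP] := phik x.
  by rewrite z0 (le_trans zp).
have H : k_ n t @[n --> U] --> k0 + \int[mu]_(x in A) (z x - sigma * k x).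
  have -> : (fun n => k_ n t) = (fun n => k0 + (\int[mu]_(x in A) y_ n x -
      sigma * \int[mu]_(x in A) k_ n x)).
    apply/funext => n; rewrite (reduced_state (kyP n) tT); congr (_ + _).
    apply: (E _ _ Phi) => //; first exact: reduced_measurable (kyP n).
    exact: measurable_state (kyP n).
  rewrite (E _ _ Phi)//; apply: cvgD; first exact: cvg_cst.
  apply: cvgB; first exact: yz.
  apply: cvgM; first exact: cvg_cst.
  apply: uniform_cvg_Rintegral => //; first exact: subDfin.
  by move=> e e0; apply: filterS (state_uniform e0) => n hn x /AD; exact: hn.
transitivity (lim (k_ n t @[n --> U])); first by apply/esym/cvg_lim.
exact/cvg_lim.
Qed.

Let limsup_arith (S Rn Rk P Pk Y Yk E r : R) :
  Rn <= Rk + (P - Y - (Pk - Yk)) + E -> `|Pk - P| <= r / 4 ->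
  `|Yk - Y| <= r / 4 -> S - r / 4 <= Rn -> 0 < r -> S <= Rk + E + r.
Proof. by move=> ? /ler_normlP[? ?] /ler_normlP[? ?] ? ?; lra. Qed.

(** Upper semicontinuity of the objective along the sequence. *)
Lemma reward_limsup (S : R) :
  (forall e, 0 < e -> \forall n \near U, S - e <= reward (k_ n) (y_ n)) ->
  S <= reward k z.
Proof.
move=> hS; have kz := process_limit.
have Phi0 : 0 <= Phi by have /andP[] := phik 0; exact: le_trans.
have Phi1 : 0 <= Phi + 1 by lra.
pose c x := phi (k x) - z x; pose c_ n x := phi (k_ n x) - y_ n x.
have c0 x : 0 <= c x <= Phi := consumption_range kz x.
have c_0 n x : 0 <= c_ n x <= Phi := consumption_range (kyP n) x.
have mc : measurable_fun setT c := measurable_consumption kz.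
have mc_ n : measurable_fun setT (c_ n) := measurable_consumption (kyP n).
have [B wB] := segment_bounded Phi0 cw.
have Irho : mu.-integrable D (EFin \o rho).
  by apply: (@D_integrable _ _ 1) => // x xT; rewrite ger0_norm//; exact: rho1.
pose V := \int[mu]_(x in D) rho x.
suff key eta : 0 < eta -> S <= reward k z + 2 * eta * V.
  have V0 : 0 <= V by apply: Rintegral_ge0.
  apply/ler_addgt0Pr => e e0.
  have V1 : 0 < 2 * (V + 1) by lra.
  have /key : 0 < e / (2 * (V + 1)) by rewrite divr_gt0.
  move/le_trans; apply; rewrite lerD2l.
  have -> : 2 * (e / (2 * (V + 1))) * V = e * (V / (V + 1)).
    by field; rewrite gt_eqF// ltr_wpDl.
  by rewrite ler_piMr// ?(ltW e0)// ler_pdivrMr ?ltr_wpDl// mul1r lerDl.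
move=> eta0.
have [d d0 osc] := segment_uniform_continuous Phi1 cw eta0.
pose e := Num.min d 1.
have e0 : 0 < e by rewrite lt_min d0 ltr01.
have e1 : e <= 1 by rewrite ge_min lexx orbT.
have ed : e <= d by rewrite ge_min lexx.
have osc' x y : 0 <= x <= Phi + e -> 0 <= y <= Phi + e -> `|x - y| <= e ->
    `|w x - w y| <= eta.
  move=> /andP[x0 xe] /andP[y0 ye] xy; apply: osc; last exact: le_trans ed.
    by rewrite x0/=; lra.
  by rewrite y0/=; lra.
(* the slope of the secant of w based at the limit consumption *)
pose p x := (w (c x + e) - w (c x)) / e.
have mp : measurable_fun setT p.
  apply: measurable_funM => //; apply: measurable_funB.
    by apply: measurableT_comp => //; exact: measurable_funD.
  exact: measurableT_comp.
have pB x : `|p x| <= eta / e.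
  rewrite /p normrM (ger0_norm (_ : 0 <= e^-1)) ?invr_ge0 ?(ltW e0)//.
  rewrite ler_wpM2r ?invr_ge0 ?(ltW e0)//; have /andP[c1 c2] := c0 x.
  apply: osc'; try (apply/andP; split; lra).
  by rewrite (addrC (c x)) addrK gtr0_norm.
pose pr x := p x * rho x.
have mpr : measurable_fun setT pr by exact: measurable_funM.
have prB x : D x -> `|pr x| <= eta / e.
  rewrite /D/= in_itv/= => xT; rewrite normrM (ger0_norm (rho0 x)) -[leRHS]mulr1.
  by apply: ler_pM => //; exact: rho1.
have prI (f : R -> R) : measurable_fun setT f -> (forall x, 0 <= f x <= Phi) ->
    mu.-integrable D (EFin \o (fun x => pr x * f x)).
  move=> mf fPhi; apply: (@D_integrable _ _ (eta / e * Phi)) => //; first exact: measurable_funM.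
  move=> x xT; have /andP[f0 fP] := fPhi x.
  by rewrite normrM; apply: ler_pM => //; [apply: prB; rewrite /D/= in_itv|rewrite ger0_norm].
have z_Phi x : 0 <= z x <= Phi.
  have /andP[z0 zp] := zk x; have /andP[_ pP] := phik x.
  by rewrite z0 (le_trans zp).
have my_ n : measurable_fun setT (y_ n) := reduced_measurable (kyP n).
have H1 : \int[mu]_(x in D) (pr x * phi (k_ n x)) @[n --> U] -->
    \int[mu]_(x in D) (pr x * phi (k x)).
  apply: uniform_cvg_Rintegral => //.
  - by move=> n; exact: prI.
  - exact: prI.
  - move=> r r0; have q0 : 0 < eta / e by rewrite divr_gt0.
    have rq : 0 < r / (eta / e) by rewrite divr_gt0.
    apply: filterS (production_uniform rq) => n hn x Dx.
    rewrite -mulrBr normrM.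
    have -> : r = eta / e * (r / (eta / e)) by rewrite mulrC divfK// gt_eqF.
    by apply: ler_pM => //; [exact: prB|exact: hn].
have H2 : \int[mu]_(x in D) (pr x * y_ n x) @[n --> U] -->
    \int[mu]_(x in D) (pr x * z x).
  exact: (@weak_cvg_bounded_test _ _ _ mu D U y_ z Phi mD finD PU my_ mz y_Phi z_Phi yz
    pr (eta / e) mpr prB).
have Iw n : mu.-integrable D (EFin \o (fun x => w (c_ n x) * rho x)).
  exact: (reward_integrable (kyP n) wB).
have Iwk : mu.-integrable D (EFin \o (fun x => w (c x) * rho x)).
  exact: (reward_integrable kz wB).
have Ip n := prI _ (mphin n) (phin n).
have Iy n := prI _ (my_ n) (y_Phi n).
have Ipk := prI _ mpk phik.
have Iz := prI _ mz z_Phi.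
pose a n x := pr x * phi (k_ n x) - pr x * y_ n x.
pose a0 x := pr x * phi (k x) - pr x * z x.
have Ia n : mu.-integrable D (EFin \o a n).
  exact: (@integrableB _ _ _ mu D mD _ _ (Ip n) (Iy n)).
have Ia0 : mu.-integrable D (EFin \o a0).
  exact: (@integrableB _ _ _ mu D mD _ _ Ipk Iz).
have Iaa n : mu.-integrable D (EFin \o (fun x => a n x - a0 x)).
  exact: (@integrableB _ _ _ mu D mD _ _ (Ia n) Ia0).
have Ier : mu.-integrable D (EFin \o (fun x => 2 * eta * rho x)).
  apply: (@D_integrable _ _ (2 * eta * 1)) => //; first exact: measurable_funM.
  move=> x xT; rewrite ger0_norm; last by rewrite mulr_ge0//; lra.
  by rewrite ler_wpM2l//; [lra|exact: rho1].
have Iwaa n : mu.-integrable D (EFin \o (fun x => w (c x) * rho x + (a n x - a0 x))).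
  exact: (@integrableD _ _ _ mu D mD _ _ Iwk (Iaa n)).
have Itot n : mu.-integrable D
    (EFin \o (fun x => w (c x) * rho x + (a n x - a0 x) + 2 * eta * rho x)).
  exact: (@integrableD _ _ _ mu D mD _ _ (Iwaa n) Ier).
have le_n n : reward (k_ n) (y_ n) <= reward k z +
    ((\int[mu]_(x in D) (pr x * phi (k_ n x)) - \int[mu]_(x in D) (pr x * y_ n x)) -
     (\int[mu]_(x in D) (pr x * phi (k x)) - \int[mu]_(x in D) (pr x * z x))) +
    2 * eta * V.
  apply: (@le_trans _ _ (\int[mu]_(x in D)
      (w (c x) * rho x + (a n x - a0 x) + 2 * eta * rho x))).
    apply: le_Rintegral => //; [exact: Iw|move=> x _].
    have := concave_le_secant concw e0 osc' (c0 x) (c_0 n x); rewrite -/(p x) => H.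
    have -> : w (c x) * rho x + (a n x - a0 x) + 2 * eta * rho x =
       (w (c x) + p x * (c_ n x - c x) + 2 * eta) * rho x.
      by rewrite /a /a0 /pr /c /c_; ring.
    exact: ler_wpM2r.
  by rewrite RintegralD// RintegralD// RintegralB// RintegralB// RintegralB// RintegralZl.
apply/ler_addgt0Pr => r r0; have r40 : 0 < r / 4 by lra.
move/cvgrPdist_le : H1 => /(_ _ r40) H1; move/cvgrPdist_le : H2 => /(_ _ r40) H2.
have [n [[h1 h2] h3]] := filter_ex (filterI (filterI H1 H2) (hS _ r40)).
exact: limsup_arith (le_n n) h1 h2 h3 r0.
Qed.

End maximizing.

(** The reduced problem has a maximizer as soon as it has a process. *)
Theorem reduced_maximum : (exists k y, reduced_process k y) ->
  exists k y, reduced_process k y /\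
    forall k' y', reduced_process k' y' -> reward k' y' <= reward k y.
Proof.
move=> [ka [ya kya]].
have Phi0 : 0 <= Phi.
  by have /andP[] := phiP (reduced_range kya 0); exact: le_trans.
have [B wB] := segment_bounded Phi0 cw.
pose S := [set r | exists k y, reduced_process k y /\ r = reward k y].
have supS : has_sup S.
  split; first by exists (reward ka ya), ka, ya.
  by exists (B * (T - t0)) => _ [k [y [ky ->]]]; exact: reward_le.
have ex n : exists ky : (R -> R) * (R -> R), reduced_process ky.1 ky.2 /\
    sup S - n.+1%:R^-1 < reward ky.1 ky.2.
  have n0 : 0 < n.+1%:R^-1 :> R by [].
  have [_ [k [y [ky ->]]] h] := sup_adherent n0 supS.
  by exists (k, y).
pose ky_ n := projT1 (cid (ex n)).
have kyP n : reduced_process (ky_ n).1 (ky_ n).2.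
  by rewrite /ky_; case: cid => ? [].
have kyS n : sup S - n.+1%:R^-1 < reward (ky_ n).1 (ky_ n).2.
  by rewrite /ky_; case: cid => ? [].
have [U [UU sU]] := @ultraFilterLemma nat (nbhs \oo) _.
have [k [kU kL kK]] := state_limit kyP UU.
have [z [mz zk yz]] := control_limit kyP UU kU kL kK.
exists k, z; split; first exact: (process_limit kyP UU kU kL kK mz zk yz).
move=> k' y' ky'; apply: (@le_trans _ _ (sup S)).
  by apply: (ub_le_sup supS.2); exists k', y'.
apply: (reward_limsup kyP UU kU kL kK mz zk yz) => e e0.
apply: sU; near=> n.
apply: le_trans (ltW (kyS n)); rewrite lerD2l lerN2.
by apply: ltW; near: n; exact: near_infty_natSinv_lt (PosNum e0).
Unshelve. all: by end_near. Qed.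

End reduced_problem.

(** * Extension to the real line, and a priori bounds *)

Section extension.
Context {R : realType}.
Implicit Types f : R -> R.

Lemma continuous_max0 f : {within `[0, +oo[, continuous f} ->
  continuous (fun x : R => f (Num.max 0 x)).
Proof.
move=> /subspace_continuousP cf x.
have h : `[0, +oo[%classic (Num.max 0 x) by rewrite /= in_itv/= andbT le_max lexx.
have cmax : continuous (fun z : R => Num.max 0 z).
  apply: (@lipschitz_continuous _ _ 1) => s t; rewrite mul1r.
  have := ler_norm (s - t); have := ler_norm (t - s); rewrite distrC => ? ?.
  by apply/ler_normlP; case: (leP 0 s) => ?; case: (leP 0 t) => ?; split; lra.
apply: (@cvg_comp _ _ _ (fun z : R => Num.max 0 z) f _ _ _ _ (cf _ h)) => P WP.
have : nbhs x (fun z => `[0, +oo[%classic (Num.max 0 z) -> P (Num.max 0 z)).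
  exact: cmax x _ WP.
rewrite -[X in _ -> X]/(nbhs x (fun z => P (Num.max 0 z))).
apply: filterS => z; apply.
by rewrite /= in_itv/= andbT le_max lexx.
Qed.

(** The extension by a constant is not concave on the whole line in general, but
    it agrees with [f] on the half-line. *)
Lemma concave_max0 f : concave_function `[0, +oo[ f ->
  concave_function `[0, +oo[ (fun x : R => f (Num.max 0 x)).
Proof.
move=> cf t x y x0 y0.
have [X0 Y0] : 0 <= x /\ 0 <= y.
  by move: x0 y0; rewrite !inE/= !in_itv/= !andbT.
rewrite (max_r X0) (max_r Y0) max_r; first exact: cf.
have -> : conv t (x : convex_lmodType R^o) y = t%:num * x + (1 - t%:num) * y by [].
by rewrite addr_ge0// mulr_ge0//.
Qed.

Lemma expR_increment (x y : R) : x <= y ->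
  0 <= expR y - expR x <= expR y * (y - x).
Proof.
move=> xy; apply/andP; split; first by rewrite subr_ge0 ler_expR.
have -> : expR x = expR y * expR (x - y) by rewrite -expRD addrC subrK.
have := expR_ge1Dx (x - y).
move=> h; rewrite -{1}[expR y]mulr1 -mulrBr ler_wpM2l ?expR_ge0//.
by lra.
Qed.

Lemma is_derive_expR_affine (a m t : R) :
  is_derive t 1 (fun x => expR (m * (x - a))) (m * expR (m * (t - a))).
Proof.
have h : is_derive t 1 (fun x => m * (x - a)) m.
  have -> : (fun x => m * (x - a)) = m *: (fun x => x - a) by [].
  have := @is_deriveZ _ _ _ (fun x : R => x - a) m t 1 1.
  by rewrite /GRing.scale/= mulr1; apply; rewrite -[X in is_derive _ _ _ X]subr0; apply: is_deriveB.
rewrite mulrC.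
have := @is_derive1_comp R expR (fun x => m * (x - a)) t _ _ (is_derive_expR _) h.
by [].
Qed.

Lemma lipschitz_of_derivative (a b L : R) f : absolutely_continuous a b f ->
  {ae @lebesgue_measure R, forall t, t \in `[a, b] ->
     exists2 d, `|d| <= L & is_derive t 1 f d} ->
  forall s t, a <= s -> s <= t -> t <= b -> `|f t - f s| <= L * (t - s).
Proof.
move=> cf df s t as_ st tb.
have {}cf : absolutely_continuous s t f by exact: absolutely_continuousW cf.
have cNf := absolutely_continuousN cf.
have cL : absolutely_continuous s t (fun x => - L * x).
  apply: (@lipschitz_absolutely_continuous _ _ _ _ `|L|) => u v _ uv _.
  by rewrite -mulrBr normrM normrN (ger0_norm (_ : 0 <= v - u))// subr_ge0.
have dL x : is_derive x (1 : R) (fun x => - L * x) (- L).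
  have := @is_deriveZ _ _ _ (@id R) (- L) x 1 1 (is_derive_id _ _).
  by rewrite /GRing.scale/= mulr1.
have H1 : f t + - L * t <= f s + - L * s.
  apply: (absolutely_continuous_nonincreasing st (absolutely_continuousD cf cL)).
  apply: filterS df => x dfx; rewrite in_itv/= => /andP[sx xt].
  have [|d /ler_normlP[d1 d2] h] := dfx.
    by rewrite in_itv/=; apply/andP; split; lra.
  by exists (d + - L); [lra|exact: is_deriveD].
have H2 : - f t + - L * t <= - f s + - L * s.
  apply: (absolutely_continuous_nonincreasing st (absolutely_continuousD cNf cL)).
  apply: filterS df => x dfx; rewrite in_itv/= => /andP[sx xt].
  have [|d /ler_normlP[d1 d2] h] := dfx.
    by rewrite in_itv/=; apply/andP; split; lra.
  by exists (- d + - L); [lra|apply: is_deriveD].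
by apply/ler_normlP; split; lra.
Qed.

(** A Gronwall bound for [f' <= c * f + c]. With [m = 2 * (c + 1)] and [N] the
    maximum over [[a, b]] of [(f + 1) * exp (- m * (t - a))], the function
    [f - N / 2 * exp (m * (t - a))] has nonpositive derivative a.e.; comparing its
    values at [a] and at the point of maximum gives [N <= f a + 1]. *)
Lemma gronwall_ae (a b c : R) f : a <= b -> 0 <= c ->
  absolutely_continuous a b f -> (forall t, a <= t <= b -> 0 <= f t) ->
  {ae @lebesgue_measure R, forall t, t \in `[a, b] ->
     exists2 d, d <= c * f t + c & is_derive t 1 f d} ->
  forall t, a <= t <= b -> f t <= (f a + 1) * expR (2 * (c + 1) * (b - a)).
Proof.
move=> ab c0 cf f0 df.
pose m := 2 * (c + 1); have m0 : 0 < m by rewrite /m; lra.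
pose h x := (f (clamp a b x) + 1) * expR (- (m * (x - a))).
have ch : continuous h.
  move=> x; apply: cvgM.
    by apply: cvgD; [exact: absolutely_continuous_clamp|exact: cvg_cst].
  apply: continuous_comp; last exact: continuous_expR.
  apply: cvgN; apply: cvgM; first exact: cvg_cst.
  by apply: cvgB; [exact: cvg_id|exact: cvg_cst].
have [s sab hs] := EVT_max ab (continuous_subspaceT ch).
move: sab; rewrite in_itv/= => /andP[as_ sb].
set N := h s in hs.
have fN t : a <= t <= b -> f t + 1 <= N * expR (m * (t - a)).
  move=> tab; have := hs t; rewrite in_itv/= => /(_ tab).
  by rewrite /h clamp_id// expRN ler_pdivrMr// expR_gt0.
have fsN : f s + 1 = N * expR (m * (s - a)).
  rewrite /N /h clamp_id ?as_// expRN divfK// gt_eqF// expR_gt0//.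
pose g x := - (N / 2) * expR (m * (x - a)).
have N0 : 0 <= N.
  by rewrite /N /h mulr_ge0 ?expR_ge0// addr_ge0// f0// clamp_id as_.
have N20 : 0 <= N / 2 by rewrite divr_ge0.
have cg : absolutely_continuous a s g.
  apply: (@lipschitz_absolutely_continuous _ _ _ _ (N / 2 * (expR (m * (b - a)) * m))) => u v au uv vs.
  have uv' : m * (u - a) <= m * (v - a) by rewrite ler_pM2l//; lra.
  have /andP[e1 e2] := expR_increment uv'.
  rewrite /g -mulrBr normrM normrN (ger0_norm N20) (ger0_norm e1).
  rewrite -(mulrA (N / 2)) ler_wpM2l// -mulrA.
  apply: (le_trans e2); rewrite -mulrBr.
  have -> : v - a - (u - a) = v - u by ring.
  apply: ler_wpM2r; first by rewrite mulr_ge0//; lra.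
  by rewrite ler_expR ler_pM2l//; lra.
have {}cf : absolutely_continuous a s f by exact: absolutely_continuousW cf.
have H : f s + g s <= f a + g a.
  apply: (absolutely_continuous_nonincreasing as_ (absolutely_continuousD cf cg)).
  apply: filterS df => x dfx; rewrite in_itv/= => /andP[ax xs].
  have xab : a <= x <= b by apply/andP; split; lra.
  have [|d dle dd] := dfx; first by rewrite in_itv.
  exists (d + - (N / 2) * (m * expR (m * (x - a)))).
    have := fN x xab; have := f0 x xab.
    have -> : - (N / 2) * (m * expR (m * (x - a))) =
      - ((c + 1) * (N * expR (m * (x - a)))) by rewrite /m; field.
    move=> fx0 fNx.
    have : (c + 1) * (f x + 1) <= (c + 1) * (N * expR (m * (x - a))).
      by rewrite ler_wpM2l//; lra.
    lra.
  apply: is_deriveD; apply: is_deriveZ; exact: is_derive_expR_affine.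
have Na : N <= f a + 1.
  have e1 : 1 <= expR (m * (s - a)).
    by rewrite -expR0 ler_expR mulr_ge0 ?(ltW m0)//; lra.
  move: H; rewrite /g subrr mulr0 expR0.
  have : N * 1 <= N * expR (m * (s - a)) by rewrite ler_wpM2l.
  lra.
move=> t tab; have /andP[at_ tb] := tab.
apply: (@le_trans _ _ (N * expR (m * (t - a)))); first by have := fN t tab; lra.
apply: ler_pM => //.
by rewrite ler_expR ler_pM2l//; lra.
Qed.

End extension.

(** * Integrals for the completed measure *)

Section completed_measure.
Context {R : realType}.
Notation mu := (@lebesgue_measure R).

Lemma measurable_id_completed :
  measurable_fun [set: lebesgueTypeR R] (fun x : lebesgueTypeR R => (x : measurableTypeR R)).
Proof.
move=> _ A mA; rewrite setTI.
exact: sub_caratheodory.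
Qed.

Lemma measurable_fun_completed (D : set R) (f : R -> R) :
  measurable (D : set (lebesgueTypeR R)) -> measurable_fun setT f ->
  measurable_fun (D : set (lebesgueTypeR R)) (f : lebesgueTypeR R -> R).
Proof.
move=> mD mf; apply: measurable_funTS.
exact: (measurableT_comp mf measurable_id_completed).
Qed.

Lemma completed_measurable_itv (i : interval R) :
  measurable ([set` i] : set (lebesgueTypeR R)).
Proof. by apply: sub_caratheodory; exact: measurable_itv. Qed.

Lemma completed_itv_fin (a b : R) : (lebesgueR R `[a, b]%classic < +oo)%E.
Proof.
have : (mu `[a, b]%classic < +oo)%E.
  by rewrite lebesgue_measure_itv/=; case: ifP => // _; rewrite -EFinB ltry.
by [].
Qed.

Lemma integrable_completed (a b B : R) (f : R -> R) : measurable_fun setT f ->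
  (forall x, a <= x <= b -> `|f x| <= B) ->
  (lebesgueR R).-integrable `[a, b] (EFin \o f).
Proof.
move=> mf fB; apply: (@bounded_measurable_integrable _ _ _ _ _ _ B).
- exact: completed_measurable_itv.
- exact: completed_itv_fin.
- exact: (measurable_fun_completed (completed_measurable_itv _) mf).
- by move=> x; rewrite /= in_itv/=; exact: fB.
Qed.

(** Borel-Lebesgue measure is the image of the completed measure under the
    identity, which is measurable from the Lebesgue to the Borel sets. *)
Lemma Rintegral_completed (a b B : R) (f : R -> R) : measurable_fun setT f ->
  (forall x, a <= x <= b -> `|f x| <= B) ->
  \int[lebesgueR R]_(x in `[a, b]) f x = \int[mu]_(x in `[a, b]) f x.
Proof.
move=> mf fB; congr fine.
have mEf : measurable_fun (setT : set (measurableTypeR R)) (EFin \o f).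
  exact/measurable_EFinP.
have mI : measurable (`[a, b]%classic : set (measurableTypeR R)).
  exact: measurable_itv.
have H := @integral_pushforward _ _ (lebesgueTypeR R) (measurableTypeR R) R
  (fun x => x) measurable_id_completed (lebesgueR R) `[a, b]%classic (EFin \o f)
  mEf (integrable_completed mf fB) mI.
rewrite -[LHS]H; apply: eq_measure_integral => //.
exact: measurable_id_completed.
Qed.

End completed_measure.

(** * Reduction of the growth problem, and existence *)

(** With the convention [0^-1 = 0], the inverse is the pointwise limit of the
    continuous functions [x / (x ^+ 2 + n.+1%:R^-1)]. *)
Lemma measurable_inv (R : realType) : measurable_fun setT (fun x : R => x^-1).
Proof.
pose h n (x : R) := x * (x ^+ 2 + n.+1%:R^-1)^-1.
have pos n (x : R) : 0 < x ^+ 2 + n.+1%:R^-1 by rewrite ltr_wpDl// sqr_ge0.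
apply: (@measurable_fun_cvg _ _ _ _ h) => [n|x _].
  apply: continuous_measurable_fun => x; apply: cvgM; first exact: cvg_id.
  apply: cvgV; first by rewrite gt_eqF.
  by apply: cvgD; [exact: exprn_continuous|exact: cvg_cst].
have [->|x0] := eqVneq x 0.
  rewrite invr0 (_ : (fun n => h n 0) = fun=> 0); first exact: cvg_cst.
  by apply/funext => n; rewrite /h mul0r.
have -> : x^-1 = x * (x ^+ 2 + 0)^-1.
  by rewrite addr0 expr2 invfM mulrA divff// mul1r.
apply: cvgM; first exact: cvg_cst.
apply: cvgV; first by rewrite addr0 expf_neq0.
by apply: cvgD; [exact: cvg_cst|exact: cvg_harmonic].
Qed.

Section reduction.
Context {R : realType}.
Notation mu := (@lebesgue_measure R).
Variables (omega phi : R -> R) (t0 T lambda sigma k0 c : R).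
Hypotheses (ht0 : 0 <= t0) (hT : t0 < T) (hlambda : 0 <= lambda)
  (hsigma : 0 < sigma) (hk0 : 0 < k0) (hc : 0 <= c)
  (phi0 : forall x, 0 <= x -> 0 <= phi x)
  (homega : {within `[0, +oo[, continuous omega})
  (hphi : {within `[0, +oo[, continuous phi})
  (hgrowth : forall x, 0 <= x -> phi x <= (c - sigma) * x + c).

(** Bounds valid for all feasible processes, on the state, on the production and
    on the velocity of the state. *)
Definition state_max : R := (k0 + 1) * expR (2 * (c + 1) * (T - t0)).
Definition production_max : R := c * state_max + c.
Definition state_rate : R := production_max + sigma * state_max.

(* extended by constants to the left of 0, both functions are continuous on R *)
Let phi' x := phi (Num.max 0 x).
Let omega' x := omega (Num.max 0 x).

Local Notation process := (reduced_process phi' t0 T sigma k0 state_max state_rate).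
Local Notation feasible := (feasible_process omega phi t0 T lambda sigma k0).

Let cphi' : continuous phi'. Proof. exact: continuous_max0. Qed.
Let comega' : continuous omega'. Proof. exact: continuous_max0. Qed.

Let phi'E x : 0 <= x -> phi' x = phi x.
Proof. by move=> x0; rewrite /phi' max_r. Qed.

Let omega'E x : 0 <= x -> omega' x = omega x.
Proof. by move=> x0; rewrite /omega' max_r. Qed.

Lemma production_range x : 0 <= x <= state_max -> 0 <= phi' x <= production_max.
Proof.
move=> /andP[x0 xK]; rewrite phi'E// phi0//=.
apply: (le_trans (hgrowth x0)); rewrite lerD2r.
apply: (@le_trans _ _ (c * x)); last exact: ler_wpM2l.
by rewrite ler_wpM2r// gerBl ltW.
Qed.

Lemma feasible_state_range k s : feasible k s ->
  forall t, t0 <= t <= T -> 0 <= k t <= state_max.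
Proof.
move=> [kac _ /ae_completedE keq kinit /ae_completedE sc k0' _].
have kge0 t : t0 <= t <= T -> 0 <= k t.
  by move=> tT; apply: k0'; rewrite in_itv.
move=> t tT; rewrite kge0//= /state_max -kinit.
apply: (gronwall_ae (ltW hT) hc kac kge0) => //.
apply: filterS2 keq sc => u ku su uT.
exists (s u * phi (k u) - sigma * k u); last exact: ku.
have uT' : t0 <= u <= T by move: uT; rewrite in_itv.
have ku0 := kge0 _ uT'; have pk0 := phi0 ku0; have gk := hgrowth ku0.
have := su uT; rewrite in_itv/= => /andP[s0 s1].
have : s u * phi (k u) <= phi (k u) by rewrite ler_piMl.
have : 0 <= sigma * k u by rewrite mulr_ge0// ltW.
rewrite mulrBl in gk.
lra.
Qed.

Lemma feasible_velocity k s : feasible k s ->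
  {ae mu, forall t, t \in `[t0, T] ->
    exists2 d, `|d| <= state_rate & is_derive t 1 k d}.
Proof.
move=> ks; have krange := feasible_state_range ks.
move: ks => [kac _ /ae_completedE keq kinit /ae_completedE sc k0' _].
apply: filterS2 keq sc => u ku su uT.
exists (s u * phi (k u) - sigma * k u); last exact: ku.
have uT' : t0 <= u <= T by move: uT; rewrite in_itv.
have kr := krange _ uT'; have /andP[ku0 kuK] := kr.
have := production_range kr; rewrite phi'E// => /andP[p0 pP].
have := su uT; rewrite in_itv/= => /andP[s0 s1].
have h1 : s u * phi (k u) <= phi (k u) by rewrite ler_piMl.
have h2 : 0 <= s u * phi (k u) by rewrite mulr_ge0.
have h3 : 0 <= sigma * k u by rewrite mulr_ge0// ltW.
have h4 : sigma * k u <= sigma * state_max by rewrite ler_pM2l.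
have h5 : 0 <= production_max by lra.
have h6 : 0 <= sigma * state_max by lra.
by rewrite /state_rate; apply/ler_normlP; split; lra.
Qed.

Let ae_interior : {ae mu, forall t, t \in `[t0, T] -> t \in `]t0, T[}.
Proof.
apply: filterS2 (ae_neq t0) (ae_neq T) => t h1 h2.
by rewrite !in_itv/= !lt_neqAle eq_sym h1 h2.
Qed.

(** Every feasible process yields a reduced one with the same objective. *)
Lemma feasible_reduced k s : feasible k s -> exists k' y, process k' y /\
  objective omega phi t0 T lambda k s = reward omega' phi' t0 T lambda k' y.
Proof.
move=> ks; have krange := feasible_state_range ks.
have kvel := feasible_velocity ks.
have [kac ms /ae_completedE keq kinit /ae_completedE sc _ iint] := ks.
have klip := lipschitz_of_derivative kac kvel.
have rate0 : 0 <= state_rate.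
  have := klip t0 T (lexx _) (ltW hT) (lexx _) => /(le_trans (normr_ge0 _)).
  by rewrite pmulr_lge0// subr_gt0.
pose k' x := k (clamp t0 T x).
have k'E t : t0 <= t <= T -> k' t = k t by move=> tT; rewrite /k' clamp_id.
have k'range t : 0 <= k' t <= state_max.
  by apply: krange; exact: clamp_itv (ltW hT).
have k'lip u v : `|k' u - k' v| <= state_rate * `|u - v|.
  wlog uv : u v / u <= v.
    move=> H; have [uv|/ltW uv] := leP u v; first exact: H.
    by rewrite distrC (distrC u); exact: H.
  have /andP[c1 c2] := clamp_lipschitz t0 T uv.
  have /andP[a1 _] := clamp_itv u (ltW hT).
  have /andP[_ a2] := clamp_itv v (ltW hT).
  rewrite distrC (distrC u) (ger0_norm (_ : 0 <= v - u)) ?subr_ge0//.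
  apply: (le_trans (klip _ _ a1 _ a2)); first by rewrite -subr_ge0.
  exact: ler_wpM2l.
have ck' : continuous k' by exact: lipschitz_continuous k'lip.
have mk' : measurable_fun setT k' by exact: continuous_measurable_fun.
have mphik : measurable_fun setT (fun t => phi' (k' t)).
  apply: measurableT_comp => //; exact: continuous_measurable_fun.
have [g [mg gL dg]] := measurable_derivative k'lip.
have dk' : {ae mu, forall t, t \in `[t0, T] ->
    is_derive t 1 k' (s t * phi (k t) - sigma * k t)}.
  apply: filterS2 keq ae_interior => t kt int_t tT.
  apply: near_eq_is_derive (kt tT).
  have := near_in_itvoo (int_t tT); apply: filterS => z.
  by rewrite in_itv/= => /andP[/ltW z1 /ltW z2]; rewrite k'E// z1.
have gE : {ae mu, forall t, t \in `[t0, T] -> g t = s t * phi (k t) - sigma * k t}.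
  by apply: filterS dk' => t kt tT; apply: dg; exact: kt.
have dk'g : {ae mu, forall t, t \in `[t0, T] -> is_derive t 1 k' (g t)}.
  by apply: filterS2 dk' gE => t kt gt tT; rewrite gt//; exact: kt.
have k'ac : absolutely_continuous t0 T k'.
  apply: (@lipschitz_absolutely_continuous _ _ _ _ state_rate) => u v _ uv _.
  by rewrite -[X in _ * X]ger0_norm ?subr_ge0//; exact: k'lip.
have k'int := absolutely_continuous_primitive k'ac mg gL dk'g.
pose y t := Num.min (Num.max 0 (g t + sigma * k' t)) (phi' (k' t)).
have my : measurable_fun setT y.
  apply: measurable_minr => //; apply: measurable_maxr => //.
  by apply: measurable_funD => //; exact: measurable_funM.
have yrange t : 0 <= y t <= phi' (k' t).
  rewrite /y le_min le_max lexx /= ge_min lexx orbT andbT.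
  by have /andP[] := production_range (k'range t).
have yE : {ae mu, forall t, t \in `[t0, T] -> y t = s t * phi (k t)}.
  apply: filterS2 gE sc => t gt st tT.
  have tT' : t0 <= t <= T by move: tT; rewrite in_itv.
  have /andP[kt0 _] := krange _ tT'.
  have := st tT; rewrite in_itv/= => /andP[s0 s1].
  rewrite /y gt// k'E// subrK phi'E// max_r; last by rewrite mulr_ge0// phi0.
  by rewrite min_l// ler_piMl// phi0.
have proc : process k' y.
  split => // t tT; rewrite k'int// k'E ?lexx ?ltW// kinit; congr (_ + _).
  congr fine; apply: ae_eq_integral => //=.
  - by apply/measurable_EFinP; exact: measurable_funTS.
  - apply/measurable_EFinP; apply: measurable_funTS; apply: measurable_funB => //.
    exact: measurable_funM.
  - apply: filterS2 gE yE => u gu yu; rewrite /= in_itv/= => /andP[u0 ut].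
    have uT : t0 <= u <= T by rewrite u0 (le_trans ut)//; have /andP[] := tT.
    have uT' : u \in `[t0, T] by rewrite in_itv.
    by rewrite gu// yu// k'E.
exists k', y; split => //.
have Phi0 : 0 <= production_max.
  by have /andP[] := production_range (k'range 0); exact: le_trans.
have [B wB] := segment_bounded Phi0 comega'.
have rB := reward_bound ht0 hlambda production_range proc wB.
have mR := measurable_reward lambda cphi' comega' proc.
rewrite /reward -(Rintegral_completed mR rB).
congr fine; apply: ae_eq_integral.
- exact: completed_measurable_itv.
- by have /integrableP[] := iint.
- apply/measurable_EFinP.
  exact: (measurable_fun_completed (completed_measurable_itv _) mR).
- apply/ae_completedE; apply: filterS2 yE sc => t yt st /= tT.
  have tT' : t0 <= t <= T by move: tT; rewrite in_itv.
  have /andP[kt0 _] := krange _ tT'.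
  have := st tT; rewrite in_itv/= => /andP[s0 s1].
  rewrite /integrand yt// k'E// phi'E// omega'E.
    by rewrite mulrBl mul1r.
  by rewrite subr_ge0 ler_piMl// phi0.
Qed.

(** Conversely, the control [s = y / phi k] realizes a reduced process. *)
Lemma reduced_feasible k y : process k y -> exists s, feasible k s /\
  objective omega phi t0 T lambda k s = reward omega' phi' t0 T lambda k y.
Proof.
move=> proc.
have krange := reduced_range proc.
have mk : measurable_fun setT k := measurable_state proc.
have mphik : measurable_fun setT (fun t => phi' (k t)) := measurable_production cphi' proc.
have my := reduced_measurable proc.
have pk t : 0 <= phi' (k t) <= production_max := production_range (krange t).
have yk := reduced_control proc.
have Phi0 : 0 <= production_max.
  by have /andP[] := pk 0; exact: le_trans.
(* where production vanishes so does y, and s is 0 by the convention 0^-1 = 0 *)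
pose s t := y t / phi' (k t).
have ms : measurable_fun setT s.
  apply: measurable_funM => //.
  exact: (measurableT_comp (@measurable_inv R) mphik).
have sE t : s t * phi (k t) = y t.
  have /andP[kt0 _] := krange t; rewrite -phi'E// /s.
  have [p0|p0] := eqVneq (phi' (k t)) 0; last by rewrite divfK.
  by have := yk t; rewrite p0 mulr0 -eq_le => /eqP.
have s01 t : 0 <= s t <= 1.
  have /andP[y0 yp] := yk t; have /andP[p0 _] := pk t.
  rewrite /s divr_ge0//=; move: p0; rewrite le_eqVlt => /orP[/eqP <-|p0].
    by rewrite invr0 mulr0.
  by rewrite ler_pdivrMr// mul1r.
have intE t : integrand omega phi lambda k s t =
    omega' (phi' (k t) - y t) * expR (- lambda * t).
  have /andP[kt0 _] := krange t; have /andP[y0 yp] := yk t.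
  by rewrite /integrand omega'E ?subr_ge0// phi'E// mulrBl mul1r sE.
have [B wB] := segment_bounded Phi0 comega'.
have rB := reward_bound ht0 hlambda production_range proc wB.
have mR := measurable_reward lambda cphi' comega' proc.
have intE' : integrand omega phi lambda k s =
    (fun t => omega' (phi' (k t) - y t) * expR (- lambda * t)).
  by apply/funext => t; exact: intE.
exists s; split; last first.
  by rewrite /objective intE' (Rintegral_completed mR rB).
have kt0 : k t0 = k0.
  have tt : t0 <= t0 <= T by rewrite lexx ltW.
  by rewrite (reduced_state proc tt) set_itv1 Rintegral_set1 addr0.
have mg : measurable_fun setT (fun t => y t - sigma * k t).
  by apply: measurable_funB => //; exact: measurable_funM.
have gB t : `|y t - sigma * k t| <= production_max + sigma * state_max.
  have /andP[y0 yp] := yk t; have /andP[p0 pP] := pk t.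
  have /andP[k0' kK] := krange t.
  rewrite (le_trans (ler_normB _ _))// lerD//.
    by rewrite ger0_norm// (le_trans yp).
  by rewrite ger0_norm; [rewrite ler_pM2l|rewrite mulr_ge0// ltW].
have kE t : t0 <= t <= T ->
    k t = k t0 + \int[mu]_(x in `[t0, t]) (y x - sigma * k x).
  by rewrite kt0; exact: (reduced_state proc).
have [kac kd] := primitive_absolutely_continuous mg gB kE.
split => //.
- exact: (measurable_fun_completed (completed_measurable_itv _) ms).
- apply/ae_completedE; apply: filterS kd => t kt tT.
  by rewrite sE; exact: kt.
- by apply/ae_completedE; apply: filterE => t _; rewrite in_itv/=.
- by move=> t _; have /andP[] := krange t.
- by rewrite intE'; exact: (integrable_completed mR rB).
Qed.

(** Consuming everything, that is [s = 0], is feasible. *)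
Lemma feasible_no_investment :
  feasible (fun t => k0 * expR (- sigma * (t - t0))) (fun=> 0).
Proof.
set k := fun t => _.
have k_ge0 t : 0 <= k t by rewrite mulr_ge0 ?expR_ge0// ltW.
have dk t : is_derive t (1 : R) k (- sigma * k t).
  have -> : - sigma * k t = k0 * (- sigma * expR (- sigma * (t - t0))).
    by rewrite /k mulrCA.
  by apply: is_deriveZ; exact: is_derive_expR_affine.
have kle t : t0 <= t -> k t <= k0.
  move=> tt; rewrite /k -[leRHS]mulr1 ler_pM2l// -expR0 ler_expR mulNr oppr_le0.
  by rewrite mulr_ge0 ?subr_ge0// ltW.
have ck : continuous k.
  move=> t; apply: differentiable_continuous.
  by apply/derivable1_diffP; have [] := dk t.
have ci : continuous (integrand omega' phi' lambda k (fun=> 0)).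
  move=> t; apply: cvgM.
    apply: continuous_comp; last exact: comega'.
    apply: cvgM; first exact: cvg_cst.
    by apply: continuous_comp; [exact: ck|exact: cphi'].
  apply: continuous_comp; last exact: continuous_expR.
  by apply: cvgM; [exact: cvg_cst|exact: cvg_id].
have intE : integrand omega phi lambda k (fun=> 0) =
    integrand omega' phi' lambda k (fun=> 0).
  apply/funext => t; rewrite /integrand subr0 !mul1r phi'E// omega'E//.
  exact: phi0.
split.
- apply: (@lipschitz_absolutely_continuous _ _ _ _ (k0 * sigma)) => u v u0 uv _.
  have vu : - sigma * (v - t0) <= - sigma * (u - t0).
    by rewrite !mulNr lerN2 ler_pM2l// lerD2r.
  have /andP[e1 e2] := expR_increment vu.
  have Eu : expR (- sigma * (u - t0)) <= 1.
    by rewrite -expR0 ler_expR mulNr oppr_le0 mulr_ge0 ?subr_ge0// ltW.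
  rewrite /k -mulrBr normrM (gtr0_norm hk0) -mulrA ler_pM2l//.
  rewrite distrC (ger0_norm e1); apply: (le_trans e2).
  have -> : - sigma * (u - t0) - - sigma * (v - t0) = sigma * (v - u) by ring.
  by rewrite ler_piMl// mulr_ge0 ?subr_ge0// ltW.
- exact: measurable_cst.
- by apply/ae_completedE; apply: filterE => t _; rewrite mul0r sub0r -mulNr.
- by rewrite /k subrr mulr0 expR0 mulr1.
- by apply/ae_completedE; apply: filterE => t _; rewrite in_itv/= lexx ler01.
- by [].
- have [B hB] := segment_bounded (ltW hT) ci.
  rewrite intE; apply: (integrable_completed _ hB).
  exact: continuous_measurable_fun.
Qed.

End reduction.

Theorem theorem3p1 (R : realType) (F : R -> R -> R) (omega : R -> R)
    (t0 T lambda sigma k0 : R)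
    (hF : production_function F)
    (ht0 : 0 <= t0) (hT : t0 < T) (hlambda : 0 <= lambda)
    (hsigma : 0 < sigma) (hk0 : 0 < k0)
    (homega : {within `[0, +oo[, continuous omega})
    (hphi : {within `[0, +oo[, continuous (per_capita F)})
    (hconcave : concave_function `[0, +oo[ omega)
    (hgrowth : exists2 c : R, 0 <= c &
      forall k : R, 0 <= k -> per_capita F k <= (c - sigma) * k + c) :
  exists k s : R -> R,
    global_solution omega (per_capita F) t0 T lambda sigma k0 k s.
Proof.
have [c hc hgc] := hgrowth.
have phi0 x : 0 <= x -> 0 <= per_capita F x.
  by move=> x0; have [F0 _] := hF; exact: F0.
have [|k [y [ky kymax]]] := @reduced_maximum R _ _ t0 T lambda sigma k0
  (state_max t0 T k0 c) (state_rate t0 T sigma k0 c) (production_max t0 T k0 c)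
  ht0 hT hlambda (continuous_max0 hphi) (continuous_max0 homega)
  (production_range hsigma hc phi0 hgc) (concave_max0 hconcave).
  have /(feasible_reduced ht0 hT hlambda hsigma hc phi0 homega hphi hgc) :=
    feasible_no_investment lambda hT hsigma hk0 phi0 homega hphi.
  by move=> [k [y [ky _]]]; exists k, y.
have [s [ks ksE]] := reduced_feasible ht0 hT hlambda hsigma hc phi0 homega hphi hgc ky.
exists k, s; split => // k' s'.
move=> /(feasible_reduced ht0 hT hlambda hsigma hc phi0 homega hphi hgc).
by move=> [k1 [y1 [ky1 ->]]]; rewrite ksE; exact: kymax.
Qed.
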